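(* Let $r\ge 4$, $s\in\mathbb{N}$ and $\gamma>0$. If $p=p(n)$ satisfies $n^{-1/2}\ll p\ll 1$, then with high probability $G(n,p)$ contains a spanning subgraph $G$ with \[ \chi(G)\ge s\qquad\text{and}\qquad \delta(G)\ge\Big(\frac{r-2}{r-1}-\gamma\Big)pn, \] such that every $s$-vertex subgraph of $G$ is $(r-1)$-colourable. In particular, $\delta_\chi(H,p)\ge\pi(H)$ for every graph $H$ with $\chi(H)\ge 4$ (and every such $p$).
   Context: $G(n,p)$ denotes the Erdős–Rényi random graph on $n$ vertices in which each pair is an edge independently with probability $p=p(n)$. ''With high probability'' means with probability tending to $1$ as $n\to\infty$. For functions $f,g$ of $n$, $f\ll g$ means $f/g\to 0$ as $n\to\infty$. $\delta(G)$ is the minimum degree. $\pi(H)=1-\frac{1}{\chi(H)-1}$. For a graph $H$ and $p=p(n)\in[0,1]$, $\delta_\chi(H,p)$ is the infimum over $d>0$ such that there exists $C>0$ (which may depend on $H$, $p$, $d$ but not on $n$) for which, with high probability, every $H$-free spanning subgraph $G\subset G(n,p)$ with $\delta(G)\ge dpn$ satisfies $\chi(G)\le C$. *)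

(* Defs.v *)
From HB Require Import structures.
From mathcomp Require Import all_boot all_order all_algebra.
From mathcomp Require Import all_classical all_reals all_analysis.

Set Implicit Arguments.
Unset Strict Implicit.
Unset Printing Implicit Defensive.

Import Order.TTheory GRing.Theory Num.Theory.
Import numFieldNormedType.Exports.

Local Open Scope classical_set_scope.
Local Open Scope ring_scope.

Section Graphs.
Local Open Scope nat_scope.

Record sgraph (V : finType) := SGraph {
  edges : {set {set V}};
  edgesP : [forall e in edges, #|e| == 2] }.

HB.instance Definition _ (V : finType) := [isSub for @edges V].
HB.instance Definition _ (V : finType) := [Finite of sgraph V by <:].

(* [set x; x] is a singleton, so adj G is irreflexive. *)
Definition adj (V : finType) (G : sgraph V) : rel V :=
  fun x y => [set x; y]%SET \in edges G.

Definition spanning_subgraph (V : finType) (G Gam : sgraph V) : Prop :=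
  edges G \subset edges Gam.

Definition degree (V : finType) (G : sgraph V) (x : V) : nat :=
  #|[set y | adj G x y]%SET|.

(* Every degree is less than #|V|, so the default value #|V| matters only
   when V is empty, where the minimum degree is 0. *)
Definition min_degree (V : finType) (G : sgraph V) : nat :=
  \big[minn/#|V|]_(x : V) degree G x.

Definition colourable (V : finType) (G : sgraph V) (k : nat) : bool :=
  [exists f : {ffun V -> 'I_k}, forall x, forall y, adj G x y ==> (f x != f y)].

Lemma colourable_card (V : finType) (G : sgraph V) : exists k, colourable G k.
Proof.
exists #|V|; apply/existsP; exists [ffun x => enum_rank x].
apply/forallP => x; apply/forallP => y; apply/implyP => xy.
rewrite !ffunE (inj_eq enum_rank_inj); apply/negP => /eqP exy; move: xy.
rewrite /adj -exy finset.setUid => /(forall_inP (edgesP G)).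
by rewrite cards1.
Qed.

Definition chi (V : finType) (G : sgraph V) : nat := ex_minn (colourable_card G).

Definition free (W V : finType) (H : sgraph W) (G : sgraph V) : Prop :=
  ~ exists f : W -> V,
      injective f /\ forall x y, adj H x y -> adj G (f x) (f y).

(* A subgraph of G is a vertex set S together with a graph F on S, each of
   whose edges is an edge of G. *)
Definition all_subgraphs_colourable (V : finType) (G : sgraph V) (s k : nat) :
    Prop :=
  forall (S : {set V}) (F : sgraph {x : V | x \in S}),
    #|S| = s ->
    (forall x y, adj F x y -> adj G (val x) (val y)) ->
    colourable F k.

End Graphs.

Section RandomGraphs.
Variable R : realType.

Definition Gnp_weight (n : nat) (p : R) (G : sgraph 'I_n) : R :=
  \prod_(e : {set 'I_n} | #|e| == 2%N) (if e \in edges G then p else 1 - p).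

Definition Gnp_prob (n : nat) (p : R) (A : set (sgraph 'I_n)) : R :=
  \sum_(G : sgraph 'I_n | G \in A) Gnp_weight p G.

Definition whp (p : nat -> R) (A : forall n, set (sgraph 'I_n)) : Prop :=
  Gnp_prob (p n) (A n) @[n --> \oo] --> (1 : R).

(* Since x / 0 = 0 here, the quotient alone would allow g = 0. *)
Definition much_less (f g : nat -> R) : Prop :=
  (\forall n \near \oo, g n != 0) /\ f n / g n @[n --> \oo] --> (0 : R).

Definition chi_bounded_at (W : finType) (H : sgraph W) (p : nat -> R) (d : R) :
    Prop :=
  exists C : R, 0 < C /\
    whp p (fun n => [set Gam : sgraph 'I_n |
      forall G : sgraph 'I_n,
        spanning_subgraph G Gam -> free H G ->
        d * p n * n%:R <= (min_degree G)%:R ->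
        (chi G)%:R <= C]).

(* An infimum in the extended reals, so that it is +oo on the empty set. *)
Definition delta_chi (W : finType) (H : sgraph W) (p : nat -> R) : \bar R :=
  ereal_inf [set d%:E | d in [set d : R | 0 < d /\ chi_bounded_at H p d]].

Definition pi_graph (W : finType) (H : sgraph W) : R :=
  1 - 1 / ((chi H)%:R - 1).

End RandomGraphs.

(* Main.v *)
Require Import Defs.
From HB Require Import structures.
From mathcomp Require Import all_boot all_order all_algebra.
From mathcomp Require Import all_classical all_reals all_analysis.
From mathcomp Require Import ring lra zify.

(** The idea is to find in the random graph a set [A] of only [eps / p] vertices
    carrying a subgraph [F] which has no large independent set although every
    [s] of its vertices induce a bipartite graph.  Such a set is atypical: it
    is built greedily, each new vertex having exactly [K] neighbours in the
    current [A], pairwise far apart in [F].  A vertex does so with a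
    probability bounded below, and only a tiny proportion of the candidates
    misses a given large [I], so averaging over the candidates destroys almost
    all independent sets at each step.  Concentration holds for all the
    [n^(O(1/p))] possible states at once, its failure having probability
    [exp(-c n)].

    As [A] is small, its neighbourhood [N(A)] has only [O(eps n)] vertices and
    can be put inside the first of [r-1] almost equal parts.  Keep the edges
    between distinct parts, those from [A] to the first part, and [F].  The
    vertices of [A] then only avoid the first colour, so that locally the two
    next colours suffice for [F].  Degrees survive except at the [O(1/p)]
    vertices with many neighbours in [N(A)], which are moved to the second
    part; here [p >> n^(-1/2)] gives [1/p << p n]. *)

Set Implicit Arguments.
Unset Strict Implicit.
Unset Printing Implicit Defensive.

Import Order.TTheory GRing.Theory Num.Theory.
Import numFieldNormedType.Exports.

Definition nbrs (V : finType) (G : sgraph V) (A : {set V}) (y : V) : {set V} :=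
  [set a in A | adj G a y].

(** * Greedy construction of the locally bipartite graph *)

Section SparseDigraph.
Local Open Scope nat_scope.
Variable V : finType.
Implicit Types (E : {set V * V}) (A B I J M T : {set V}) (u v w y : V).

(** The graph under construction is a set of ordered pairs, from each new vertex to the earlier
    vertices chosen for it; [dadj] forgets the orientation. *)
Definition dadj E u v := ((u, v) \in E) || ((v, u) \in E).

Definition dnbrs E u : {set V} := [set v | dadj E u v].

Fixpoint ball E k u : {set V} :=
  if k is k'.+1 then \bigcup_(w in ball E k' u) (w |: dnbrs E w) else [set u].

Lemma dadjC E u v : dadj E u v = dadj E v u.
Proof. by rewrite /dadj orbC. Qed.

Lemma card_bigcup_le (S : finType) (P : {set S}) (F : S -> {set V}) c :
  (forall i, i \in P -> #|F i| <= c) -> #|\bigcup_(i in P) F i| <= #|P| * c.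
Proof.
move=> Fc; rewrite -sum_nat_const.
apply: (@leq_trans (\sum_(i in P) #|F i|)); last exact: leq_sum.
elim/big_rec2: _ => [|i m B _ IH]; first by rewrite cards0.
by rewrite cardsU (leq_trans (leq_subr _ _)) // leq_add2l.
Qed.

Lemma card_ball E D k u :
  (forall w, #|dnbrs E w| <= D) -> #|ball E k u| <= D.+1 ^ k.
Proof.
move=> degD; elim: k => [|k IH] /=; first by rewrite cards1.
rewrite expnSr; apply: leq_trans (leq_mul IH (leqnn _)).
apply: card_bigcup_le => w _.
by rewrite cardsU1 -add1n leq_add ?leq_b1.
Qed.

Lemma ball_le E k m u : k <= m -> ball E k u \subset ball E m u.
Proof.
elim: m => [|m IH]; first by rewrite leqn0 => /eqP ->.
rewrite leq_eqVlt => /orP[/eqP -> //|]; rewrite ltnS => /IH km.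
apply: fintype.subset_trans km _; apply/fintype.subsetP => w wm /=.
by apply/finset.bigcupP; exists w => //; rewrite !inE eqxx.
Qed.

Lemma path_ball E u p : path (dadj E) u p -> last u p \in ball E (size p) u.
Proof.
elim/last_ind: p => [|p w IH] /=; first by rewrite !inE.
rewrite rcons_path last_rcons size_rcons /= => /andP[/IH up pw].
by apply/finset.bigcupP; exists (last u p) => //; rewrite !inE pw orbT.
Qed.

Definition locally_bipartite E s :=
  forall T, #|T| <= s ->
  exists c : V -> bool, forall u v, u \in T -> v \in T -> dadj E u v -> c u != c v.

(** Asking for both memberships makes the relation symmetric by construction, as the counting of far
    sets requires. *)
Definition close E s u v := (v \in ball E s u) && (u \in ball E s v).

Definition attach E y B := E :|: [set (y, u) | u in B].

Lemma dadj_attach E y B u v :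
  dadj (attach E y B) u v =
  [|| dadj E u v, (u == y) && (v \in B) | (v == y) && (u \in B)].
Proof.
have yB a b : ((a, b) \in [set (y, u) | u in B]) = (a == y) && (b \in B).
  apply/imsetP/andP => [[w wB [-> ->]]|[/eqP -> bB]]; first by rewrite eqxx.
  by exists b.
rewrite /dadj !inE !yB.
by rewrite orbACA; case: (_ || _) => //=; rewrite orbC.
Qed.

(** Two vertices of [B] connected inside [T :\ y] would be joined there by a simple path on at most
    [s] vertices, hence be close. So each component of [T :\ y] meets [B] at most once, and its
    2-colouring can be flipped so that this vertex differs from [y]. *)
Lemma locally_bipartite_attach E s y B :
  locally_bipartite E s -> (forall u, ~~ dadj E y u) -> y \notin B ->
  (forall u v, u \in B -> v \in B -> u != v -> ~~ close E s u v) ->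
  locally_bipartite (attach E y B) s.
Proof.
move=> Eb yE yB Bfar T Ts; pose T' := T :\ y.
have T's : #|T'| <= s by apply: leq_trans Ts; rewrite subset_leq_card ?subsetDl.
have [c cP] := Eb _ T's.
pose e u v := [&& u \in T', v \in T' & dadj E u v].
have eC : connect_sym e.
  by apply: sym_connect_sym => u v; rewrite /e dadjC andbCA.
have conn_ball u v : u \in T' -> connect e u v -> v \in ball E s u.
  move=> uT /connectP[p0 /shortenP[p ep up _] ->].
  have pT : {subset u :: p <= T'}.
    move=> w; rewrite inE => /orP[/eqP -> //|].
    elim: p u {uT up} ep w => //= a p IH u /andP[/and3P[_ aT _] ep] w.
    by rewrite inE => /orP[/eqP -> //|]; apply: IH ep w.
  have pE : path (dadj E) u p by apply: sub_path ep => a b /and3P[].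
  apply: fintype.subsetP (path_ball pE); apply: ball_le; apply: leq_trans T's.
  apply: leq_trans (leqnSn _) _; rewrite -[(size p).+1]/(size (u :: p)).
  by move/card_uniqP: up => <-; apply/subset_leq_card/fintype.subsetP.
(* [rep z] is the vertex of [B] in the component of [z], if there is one; adding its colour modulo 2
   makes [c'] false on [B]. *)
pose rep z := [pick b | [&& b \in B, b \in T' & connect e b z]].
pose c' z := if z == y then true else if rep z is Some b then c z (+) c b else c z.
have c'B b : b \in B -> b \in T' -> c' b = false.
  move=> bB bT; rewrite /c'; case: eqP => [yb|_]; first by rewrite -yb bB in yB.
  rewrite /rep; case: pickP => [b' /and3P[b'B b'T b'b]|/(_ b)]; last first.
    by rewrite bB bT connect0.
  suff -> : b' = b by rewrite addbb.
  apply/eqP/negPn/negP => bb'; move/negP: (Bfar _ _ b'B bB bb'); apply.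
  by rewrite /close !conn_ball // eC.
exists c' => u v uT vT; rewrite dadj_attach.
have inT' z : z \in T -> z != y -> z \in T' by move=> zT zy; rewrite !inE zy.
case/or3P => [uv|/andP[/eqP uy vB]|/andP[/eqP vy uB]].
- have uy : u != y by apply: contraTneq uv => ->; apply: yE.
  have vy : v != y by apply: contraTneq uv => ->; rewrite dadjC; apply: yE.
  have euv : e u v by rewrite /e !inT'.
  have -> : c' u = if rep u is Some b then c u (+) c b else c u.
    by rewrite /c' (negbTE uy).
  have -> : c' v = if rep u is Some b then c v (+) c b else c v.
    rewrite /c' (negbTE vy) /rep; set r := pick _; set r' := pick _.
    (* Adjacent vertices lie in one component, so both colours are flipped or neither is. *)
    suff -> : r = r' by [].
    apply: eq_pick => b; congr [&& _, _ & _].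
    by rewrite [LHS]eC [RHS]eC; rewrite (same_connect eC (connect1 euv)).
  have := cP u v (inT' _ uT uy) (inT' _ vT vy) uv.
  by case: (rep u) => // b; case: (c u); case: (c v); case: (c b).
- have vy : v != y by apply: contraNneq yB => <-.
  by rewrite (c'B v) ?inT' // /c' uy eqxx.
- have uy : u != y by apply: contraNneq yB => <-.
  by rewrite (c'B u) ?inT' // /c' vy eqxx.
Qed.

(** * Counting the admissible neighbourhoods *)

Lemma card_pairs (S : {set {set V}}) (F : {set V} -> {set V}) :
  #|[set x : {set V} * V | (x.1 \in S) && (x.2 \in F x.1)]| = \sum_(B in S) #|F B|.
Proof.
rewrite -sum1_card; under [RHS]eq_bigr => B _ do rewrite -sum1_card.
by rewrite pair_big_dep /=; apply: eq_bigl => x; rewrite inE.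
Qed.

Definition far_sets (c : rel V) M k : {set {set V}} :=
  [set B : {set V} | [&& B \subset M, #|B| == k &
     [forall u in B, forall v in B, (u != v) ==> ~~ c u v]]].

Lemma leq_expl m m' e : m <= m' -> m ^ e <= m' ^ e.
Proof. by case: e => // e mm'; rewrite leq_exp2r. Qed.

(** A far set of size [k] extends by any vertex of [M] unrelated to its members, in at least
    [#|M| - k * b] ways, and a far set of size [k.+1] arises at most [k.+1] times. This double count
    is [step]. *)
Lemma card_far_sets (c : rel V) M b k :
  symmetric c -> reflexive c ->
  (forall w, #|[set u | c w u]| <= b) ->
  (#|M| - k * b) ^ k <= k`! * #|far_sets c M k|.
Proof.
move=> cS cR cb; elim: k => [|k IH].
  rewrite expn0 mul1n card_gt0; apply/set0Pn; exists finset.set0.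
  rewrite inE finset.sub0set cards0 eqxx /=; apply/forall_inP => u; by rewrite inE.
have step : (#|M| - k * b) * #|far_sets c M k| <= k.+1 * #|far_sets c M k.+1|.
  pose F B := M :\: \bigcup_(w in B) [set u | c w u].
  pose P := [set x : {set V} * V | (x.1 \in far_sets c M k) && (x.2 \in F x.1)].
  apply: (@leq_trans #|P|).
    rewrite card_pairs mulnC -sum_nat_const; apply: leq_sum => B.
    rewrite inE => /and3P[_ /eqP Bk _].
    rewrite cardsD leq_sub2l // (leq_trans (subset_leq_card (subsetIr _ _))) //.
    by rewrite -Bk; apply: card_bigcup_le.
  pose Q := [set x : {set V} * V | (x.1 \in far_sets c M k.+1) && (x.2 \in x.1)].
  apply: (@leq_trans #|Q|); last first.
    rewrite (card_pairs _ id) mulnC -sum_nat_const; apply: leq_sum => B.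
    by rewrite inE => /and3P[_ /eqP ->].
  have notin x : x \in P -> x.2 \notin x.1.
    rewrite inE => /andP[_]; rewrite inE => /andP[+ _]; apply: contra => x2.
    by apply/finset.bigcupP; exists x.2 => //; rewrite inE cR.
  rewrite -(@card_in_imset _ _ (fun x => (x.2 |: x.1, x.2)) (mem P)); last first.
    move=> [B u] [B' u'] /notin /= uB /notin /= uB' [+ uu']; rewrite -uu' in uB' *.
    by move=> /(congr1 (fun C => C :\ u)); rewrite !setU1K // => ->.
  apply/subset_leq_card/fintype.subsetP => _ /imsetP[[B u] BuP ->].
  have uB := notin _ BuP; move: BuP; rewrite /= in uB *.
  rewrite !inE /= => /andP[/and3P[BM /eqP Bk /forall_inP Bf] /andP[uN uM]].
  apply/andP; split; last by rewrite eqxx.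
  rewrite cardsU1 uB Bk eqxx /=.
  have uc w : w \in B -> ~~ c w u.
    move=> wB; apply: contra uN => wu; apply/finset.bigcupP; exists w => //.
    by rewrite inE.
  rewrite finset.subUset finset.sub1set uM BM /=; apply/forall_inP => w wB.
  apply/forall_inP => v vB; apply/implyP => wv.
  move: wB vB; rewrite !inE => /orP[/eqP wu|wB] /orP[/eqP vu|vB].
  - by rewrite wu vu eqxx in wv.
  - by rewrite wu cS uc.
  - by rewrite vu uc.
  - by move/forall_inP: (Bf w wB) => /(_ v vB); rewrite wv.
rewrite expnSr factS.
apply: (@leq_trans ((#|M| - k * b) ^ k * (#|M| - k * b))).
  have le : #|M| - k.+1 * b <= #|M| - k * b by rewrite leq_sub2l // leq_mul.
  by rewrite leq_mul // leq_expl.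
apply: (@leq_trans (k`! * #|far_sets c M k| * (#|M| - k * b))).
  by rewrite leq_mul.
by rewrite [k.+1 * _]mulnC -!mulnA leq_mul // mulnC.
Qed.

Lemma card_draws_fact (B : {set V}) k :
  k`! * #|[set C : {set V} | C \subset B & #|C| == k]| <= #|B| ^ k.
Proof.
rewrite cards_draws mulnC bin_ffact.
elim: k #|B| => [|k IH] m; first by rewrite ffactn0.
case: m => [|m]; first by rewrite ffact0n.
by rewrite ffactSS expnS leq_mul // (leq_trans (IH m)) // leq_expl // leqW.
Qed.

Lemma sum_dnbrs E : \sum_u #|dnbrs E u| <= 2 * #|E|.
Proof.
have -> : 2 * #|E| = \sum_u #|[set v | (u, v) \in E]| + \sum_v #|[set u | (u, v) \in E]|.
  rewrite mul2n -addnn; congr (_ + _).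
    rewrite -sum1_card; under [RHS]eq_bigr => u _ do rewrite -sum1_card.
    rewrite pair_big_dep /=; apply: eq_bigl => -[u v] /=; by rewrite inE.
  rewrite -sum1_card; under [RHS]eq_bigr => u _ do rewrite -sum1_card.
  rewrite [RHS](exchange_big_dep predT) //= pair_big_dep /=.
  by apply: eq_bigl => -[u v] /=; rewrite inE.
rewrite -big_split /=; apply: leq_sum => u _.
rewrite -cardsUI; apply: leq_trans (leq_addr _ _).
by apply/subset_leq_card/fintype.subsetP => v; rewrite !inE.
Qed.

(** The sets to which a new vertex may be attached: degrees below [D] leave room for one more edge,
    and being pairwise far preserves local bipartiteness. *)
Definition good_sets E s D K A : {set {set V}} :=
  far_sets (close E s) [set u in A | #|dnbrs E u| < D] K.

Lemma card_good_sets E s D K g A :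
  0 < s -> 0 < K -> D = 16 * K * s -> K * D.+1 ^ s <= g ->
  #|A| <= 8 * s * g -> #|E| <= K * #|A| ->
  (forall w, #|dnbrs E w| <= D) ->
  (#|A| - 2 * g) ^ K <= K`! * #|good_sets E s D K A|.
Proof.
move=> s0 K0 DE Kg AL EA degD.
have hi : #|[set u in A | D <= #|dnbrs E u|]| <= g.
  have D0 : 0 < D by nia.
  rewrite -(leq_pmul2r D0) -sum_nat_const.
  apply: (@leq_trans (\sum_u #|dnbrs E u|)).
    rewrite [leqRHS](bigID (mem [set u in A | D <= #|dnbrs E u|])) /=.
    apply: leq_trans (leq_addr _ _); apply: leq_sum => u.
    by rewrite inE => /andP[].
  apply: leq_trans (sum_dnbrs E) _; nia.
have cS : symmetric (close E s) by move=> u v; rewrite /close andbC.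
have cR : reflexive (close E s).
  move=> u; rewrite /close andbb; apply: fintype.subsetP (ball_le E u (leq0n s)) _ _.
  by rewrite inE.
have cb w : #|[set u | close E s w u]| <= D.+1 ^ s.
  apply: leq_trans (card_ball s w degD); apply/subset_leq_card/fintype.subsetP => u.
  by rewrite inE => /andP[].
apply: leq_trans (card_far_sets _ K cS cR cb).
rewrite leq_exp2r //.
have : #|A| <= #|[set u in A | D <= #|dnbrs E u|]| + #|[set u in A | #|dnbrs E u| < D]|.
  rewrite -cardsUI; apply: leq_trans (leq_addr _ _).
  apply/subset_leq_card/fintype.subsetP => u uA; rewrite !inE uA /=.
  by case: leqP.
lia.
Qed.

(** Good sets missing [I] are [K]-subsets of [A :\: I], which has at most [#|A| - 4 * g] elements.
    As [#|A| <= 8 * s * g], the ratio of this number to [#|A| - 2 * g] is at most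
    [1 - 1 / (4 * s)]. *)
Lemma card_good_sets_missing E s D K g A I :
  0 < s -> 0 < K -> D = 16 * K * s -> K * D.+1 ^ s <= g ->
  #|A| <= 8 * s * g -> #|E| <= K * #|A| ->
  (forall w, #|dnbrs E w| <= D) -> I \subset A -> 4 * g <= #|I| ->
  (4 * s) ^ K * #|[set B in good_sets E s D K A | [disjoint B & I]]| <=
  (4 * s).-1 ^ K * #|good_sets E s D K A|.
Proof.
move=> s0 K0 DE Kg AL EA degD IA gI.
have good := card_good_sets s0 K0 DE Kg AL EA degD.
rewrite -(leq_pmul2l (fact_gt0 K)).
apply: (@leq_trans ((4 * s) ^ K * (#|A| - 4 * g) ^ K)).
  rewrite mulnCA leq_mul //; apply: leq_trans (leq_expl K (leq_sub2l _ gI)).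
  rewrite -cardsDS //; apply: leq_trans (card_draws_fact _ K); rewrite leq_mul //.
  apply/subset_leq_card/fintype.subsetP => B; rewrite !inE.
  move=> /andP[/and3P[BA -> _] BI]; rewrite andbT subsetD BI andbT.
  by apply: fintype.subset_trans BA _; apply/fintype.subsetP => u; rewrite inE => /andP[].
apply: (@leq_trans ((4 * s).-1 ^ K * (#|A| - 2 * g) ^ K)); last first.
  by rewrite [leqRHS]mulnCA leq_mul.
rewrite -!expnMn leq_expl //.
have tg : 4 * g <= #|A| by apply: leq_trans gI (subset_leq_card IA).
nia.
Qed.

(** * The potential of the large independent sets *)

Definition independent_sets E A : {set {set V}} :=
  [set J : {set V} | (J \subset A) &&
     [forall u in J, forall v in J, ~~ dadj E u v]].

(** Extending [J] by the new vertex multiplies its weight by [lam], which balances the proportion at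
    most [1 / lam] of candidates whose neighbourhood misses [J]. *)
Definition potential E A h lam : nat :=
  \sum_(J in independent_sets E A | h <= #|J|) lam ^ #|J|.

(** An independent set of the new graph is an old one or some [y |: J] with [J] old and disjoint
    from [B]. In the second case either [#|J|] is at least [h], which gives the last sum, or the new
    set has exactly [h] elements, and there are at most [2 ^ #|A|] of those. *)
Lemma potential_attach E A y B h lam :
  0 < h -> y \notin A -> B \subset A ->
  potential (attach E y B) (y |: A) h lam <=
  potential E A h lam + 2 ^ #|A| * lam ^ h +
  lam * \sum_(J in independent_sets E A | (h <= #|J|) && [disjoint B & J]) lam ^ #|J|.
Proof.
move=> h0 yA BA; rewrite /potential.
have sub J : J \in independent_sets (attach E y B) (y |: A) ->
    (J :\ y \in independent_sets E A) && ((y \in J) ==> [disjoint B & J :\ y]).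
  rewrite !inE => /andP[JA /forall_inP Ji]; apply/andP; split.
    apply/andP; split; first by rewrite subDset.
    apply/forall_inP => u /finset.setD1P[_ uJ]; apply/forall_inP => v /finset.setD1P[_ vJ].
    by move/forall_inP: (Ji u uJ) => /(_ v vJ); rewrite dadj_attach negb_or => /andP[].
  apply/implyP => yJ; rewrite disjoint_sym; apply/pred0P => u /=; apply/negP.
  move=> /andP[/finset.setD1P[_ uJ] uB].
  by move/forall_inP: (Ji y yJ) => /(_ u uJ); rewrite dadj_attach eqxx uB orbT.
rewrite (bigID (fun J : {set V} => y \in J)) /= addnC -addnA; apply: leq_add.
  rewrite big_mkcond [leqRHS]big_mkcond /=; apply: leq_sum => J _.
  case: ifP => // /andP[/andP[/sub/andP[JE _] hJ] yJ].
  have Jy : J :\ y = J by apply/finset.setDidPl; rewrite disjoint_sym disjoints1.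
  by move: JE; rewrite Jy => ->; rewrite hJ.
rewrite (reindex_onto (fun J => y |: J) (fun J => J :\ y)) /=; last first.
  by move=> J /andP[_ yJ]; rewrite finset.setD1K.
rewrite -card_powerset -sum_nat_const big_distrr /=.
rewrite big_mkcond [X in _ <= X + _]big_mkcond [X in _ <= _ + X]big_mkcond /=.
rewrite -big_split /=; apply: leq_sum => J _.
case: ifP => // /andP[/andP[/andP[/sub/andP[JE Jd] hJ] yJ] /eqP JK].
rewrite JK yJ /= in JE Jd.
have yJ' : y \notin J by rewrite -JK !inE eqxx.
have cJ : #|y |: J| = #|J|.+1 by rewrite cardsU1 yJ'.
rewrite cJ in hJ *; rewrite JE Jd powersetE.
have -> : J \subset A by move: JE; rewrite inE => /andP[].
rewrite andbT; case: (leqP h #|J|) => Jh; first by rewrite expnS leq_addl.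
by rewrite addn0 (_ : #|J|.+1 = h) //; apply/eqP; rewrite eqn_leq Jh hJ.
Qed.

Lemma potential_empty A h lam :
  #|A| = h -> potential finset.set0 A h lam <= lam ^ h.
Proof.
move=> Ah; rewrite /potential (big_pred1 A) ?Ah // => J /=.
rewrite inE -andbA; apply/and3P/eqP => [[JA _ hJ]|->].
  by apply/eqP; rewrite eqEcard JA Ah.
rewrite Ah; split=> //.
by apply/forall_inP => u _; apply/forall_inP => v _; rewrite /dadj !inE.
Qed.

Lemma card_dnbrs_attach E A y B D w :
  E \subset finset.setX A A -> y \notin A -> B \subset A -> #|B| <= D ->
  (forall u, u \in B -> #|dnbrs E u| < D) -> #|dnbrs E w| <= D ->
  #|dnbrs (attach E y B) w| <= D.
Proof.
move=> EA yA BA BD Bdeg wD.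
have yE u : dadj E y u = false.
  apply/negP => /orP[] /(fintype.subsetP EA); rewrite inE (negbTE yA) ?andbF //.
have yB : y \notin B by apply: contra yA; apply: fintype.subsetP.
have [->|wy] := eqVneq w y.
  rewrite (_ : dnbrs _ _ = B) //; apply/setP => u; rewrite inE dadj_attach yE eqxx /=.
  by rewrite (negbTE yB) andbF orbF.
case: (boolP (w \in B)) => wB.
  apply: leq_trans (Bdeg w wB); rewrite -[X in _ <= X]add1n -(cards1 y).
  rewrite -cardsUI; apply: leq_trans (leq_addr _ _).
  apply/subset_leq_card/fintype.subsetP => u.
  by rewrite !inE dadj_attach (negbTE wy) wB andbT /= orbC.
rewrite (_ : dnbrs _ _ = dnbrs E w) //; apply/setP => u.
by rewrite !inE dadj_attach (negbTE wy) (negbTE wB) andbF !orbF.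
Qed.

Lemma adjC (G : sgraph V) u v : adj G u v = adj G v u.
Proof. by rewrite /adj finset.setUC. Qed.

(* The next vertex is chosen, by averaging over all candidates, so that the
   potential at most about doubles; an independent set of size [2 * h] would
   make it too large at the end. *)
Lemma locally_bipartite_no_large_independent (G : sgraph V) s K D h L lam :
  0 < h -> h <= L -> K <= D -> h <= #|V| -> 8 ^ L < lam ^ h ->
  (forall A E, h <= #|A| -> #|A| < L -> E \subset finset.setX A A ->
     #|E| <= K * #|A| -> (forall w, #|dnbrs E w| <= D) ->
     let Q := [set y in ~: A | nbrs G A y \in good_sets E s D K A] in
     0 < #|Q| /\ forall I, I \subset A -> h <= #|I| ->
       lam * #|[set y in Q | [disjoint nbrs G A y & I]]| <= #|Q|) ->
  exists A E, [/\ #|A| = L, forall u v, dadj E u v -> adj G u v,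
    locally_bipartite E s & forall J, J \in independent_sets E A -> #|J| < 2 * h].
Proof.
move=> h0 hL KD hV lam8 step.
have lam0 : 0 < lam by case: lam lam8 {step} => //; rewrite exp0n.
(* [W] bounds the contribution of new sets of size [h] at every stage. With it added, the potential
   at most doubles per step, starting from at most [2 * W]. *)
pose W := 2 ^ L * lam ^ h.
suff /(_ (L - h)) : forall k, k <= L - h -> exists A E,
    [/\ #|A| = h + k, E \subset finset.setX A A, #|E| <= K * #|A|,
       forall w, #|dnbrs E w| <= D & [/\ forall u v, dadj E u v -> adj G u v,
       locally_bipartite E s & potential E A h lam + W <= 2 ^ k.+1 * W]].
  move=> /(_ (leqnn _)) [A [E [AL _ _ _ [EG Eb pot]]]].
  exists A, E; split=> //; first by rewrite AL subnKC.
  move=> J Ji; rewrite ltnNge; apply/negP => hJ.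
  (* The set [J] alone contributes at least [lam ^ (2 * h)]. Cancelling [lam ^ h] leaves [lam ^ h]
     bounded by a power of 2 with exponent at most [3 * L], against [8 ^ L < lam ^ h]. *)
  have : lam ^ (2 * h) <= 2 ^ (L - h).+1 * W.
    apply: leq_trans (leq_trans (leq_addr _ _) pot).
    rewrite /potential (bigD1 J) /=; last by rewrite Ji (leq_trans _ hJ) // leq_pmull.
    by apply: leq_trans (leq_addr _ _); rewrite leq_pexp2l.
  rewrite mul2n -addnn expnD /W mulnA leq_pmul2r ?expn_gt0 ?lam0 // -expnD.
  rewrite leqNgt (leq_ltn_trans _ lam8) // -[8]/(2 ^ 3) -expnM leq_pexp2l //.
  lia.
elim=> [_|k IH kL].
  have [A Ah] : exists A : {set V}, #|A| = h.
    have : 0 < #|[set A : {set V} | A \subset [set: V] & #|A| == h]|.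
      by rewrite cards_draws cardsT bin_gt0.
    by rewrite card_gt0 => /set0Pn[A]; rewrite inE => /andP[_ /eqP <-]; exists A.
  exists A, finset.set0; rewrite Ah addn0 cards0 finset.sub0set; split=> //.
    move=> w; rewrite (_ : dnbrs _ _ = finset.set0) ?cards0 //.
    by apply/setP => u; rewrite !inE /dadj !inE.
  split.
  - by move=> u v; rewrite /dadj !inE.
  - by move=> T _; exists (fun=> true) => u v _ _; rewrite /dadj !inE.
  - rewrite expn1 mul2n -addnn leq_add2r /W.
    by apply: leq_trans (potential_empty lam Ah) _; rewrite leq_pmull ?expn_gt0.
have [A [E [Ak EA EK degD [EG Eb pot]]]] := IH (ltnW kL).
have hA : h <= #|A| by rewrite Ak leq_addr.
have AL : #|A| < L by lia.
have [Q0 QI] := step A E hA AL EA EK degD.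
set Q := [set y in _ | _] in Q0 QI.
pose missed y := \sum_(J in independent_sets E A |
  (h <= #|J|) && [disjoint nbrs G A y & J]) lam ^ #|J|.
(* Averaging over [Q]: after exchanging the sums, each [J] is missed by at most [#|Q| / lam]
   candidates, so some candidate does no worse than the mean. *)
have [y yQ ymiss] : exists2 y, y \in Q & lam * missed y <= potential E A h lam.
  apply/exists_inP; rewrite -[X in is_true X]negbK negb_exists_in.
  apply/negP => /forall_inP H.
  have : \sum_(y in Q) lam * missed y <= #|Q| * potential E A h lam.
    rewrite -big_distrr /= /missed.
    rewrite (exchange_big_dep (fun J => (J \in independent_sets E A) && (h <= #|J|))) /=;
      last by move=> y J _ /and3P[-> ->].
    rewrite /potential !big_distrr /=; apply: leq_sum => J /andP[Ji hJ].
    rewrite sum_nat_const mulnA leq_mul2r; apply/orP; right.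
    apply: leq_trans (QI J _ hJ); last by move: Ji; rewrite inE => /andP[].
    rewrite leq_mul2l; apply/orP; right.
    apply/subset_leq_card/fintype.subsetP => y.
    by rewrite unfold_in => /andP[yQ /and3P[_ _ dJ]]; rewrite inE yQ.
  rewrite leqNgt -sum_nat_const => /negP; apply.
  have [y0 y0Q] : exists y0, y0 \in Q by apply/set0Pn; rewrite -card_gt0.
  rewrite (bigD1 y0) //= [ltnRHS](bigD1 y0) //= -addSn leq_add //.
    by move: (H _ y0Q); rewrite -ltnNge.
  by apply: leq_sum => y /andP[/H + _]; rewrite -ltnNge => /ltnW.
move: yQ; rewrite inE => /andP[]; rewrite finset.in_setC => yA.
rewrite inE => /and3P[BM /eqP BK /forall_inP Bf].
set B := nbrs G A y in BM BK Bf ymiss.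
have BA : B \subset A by apply/fintype.subsetP => u; rewrite inE => /andP[].
have Bdeg u : u \in B -> #|dnbrs E u| < D.
  by move/(fintype.subsetP BM); rewrite inE => /andP[].
exists (y |: A), (attach E y B); split.
- by rewrite cardsU1 yA Ak addnS.
- apply/fintype.subsetP => -[u v]; rewrite !inE => /orP[/(fintype.subsetP EA)|].
    by rewrite inE /= => /andP[-> ->]; rewrite !orbT.
  by case/imsetP => w wB [-> ->]; rewrite eqxx (fintype.subsetP BA _ wB) orbT.
- rewrite cardsU1 yA mulnDr muln1 /attach addnC.
  apply: leq_trans (leq_add EK (leqnn K)); rewrite -[X in _ <= _ + X]BK.
  rewrite cardsU; apply: leq_trans (leq_subr _ _) _.
  by rewrite leq_add2l leq_imset_card.
- by move=> w; apply: (card_dnbrs_attach EA yA BA) => //; rewrite BK.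
- split.
  + move=> u v; rewrite dadj_attach => /or3P[/EG //|/andP[/eqP -> ]|/andP[/eqP ->]].
      by rewrite inE adjC => /andP[].
    by rewrite inE => /andP[].
  + apply: locally_bipartite_attach => //.
    * move=> u; apply/negP => /orP[] /(fintype.subsetP EA).
        by rewrite inE (negbTE yA).
      by rewrite inE (negbTE yA) andbF.
    * by apply: contra yA; apply: fintype.subsetP.
    * move=> u v uB vB uv; move/forall_inP: (Bf u uB) => /(_ v vB).
      by rewrite uv.
  + rewrite expnS -mulnA; apply: leq_trans (leq_mul (leqnn 2) pot).
    rewrite mulnDr; apply: leq_trans (leq_add (potential_attach _ _ h0 yA BA) (leqnn W)) _.
    have AW : 2 ^ #|A| * lam ^ h <= W by rewrite leq_mul // leq_pexp2l // ltnW.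
    apply: leq_trans (leq_add (leq_add (leq_add (leqnn _) AW) ymiss) (leqnn W)) _.
    by rewrite !mul2n -!addnn; move: (potential _ _ _ _) => P; lia.
Qed.

End SparseDigraph.

(** * The spanning subgraph *)

Section Assembly.
Local Open Scope nat_scope.
Variable V : finType.
Implicit Types (E : {set V * V}) (A B J S X : {set V}) (u v x y : V).

Definition restrict_edges (G : sgraph V) (r : rel V) : {set {set V}} :=
  [set e in edges G | [exists x, exists y, (e == [set x; y]) && r x y]].

Lemma restrict_edgesP (G : sgraph V) (r : rel V) :
  [forall e in restrict_edges G r, #|e| == 2].
Proof.
apply/forall_inP => e; rewrite inE => /andP[eG _].
by have /forall_inP := edgesP G; apply.
Qed.

Definition restrict (G : sgraph V) (r : rel V) : sgraph V :=
  SGraph (restrict_edgesP G r).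

Lemma adj_restrict (G : sgraph V) (r : rel V) x y :
  symmetric r -> adj (restrict G r) x y = adj G x y && r x y.
Proof.
move=> rC; rewrite /adj inE; apply: andb_id2l => _.
apply/existsP/idP => [[x' /existsP[y' /andP[/eqP e rxy]]]|rxy]; last first.
  by exists x; apply/existsP; exists y; rewrite eqxx.
have := finset.set21 x y; rewrite e !inE => xe.
have := finset.set22 x y; rewrite e !inE => ye.
have := finset.set21 x' y'; rewrite -e !inE => xe'.
have := finset.set22 x' y'; rewrite -e !inE => ye'.
case/orP: xe => /eqP ex; case/orP: ye => /eqP ey; rewrite ex ey in xe' ye' *.
- by move: ye' rxy; rewrite orbb => /eqP ->.
- by [].
- by rewrite rC.
- by move: xe' rxy; rewrite orbb => /eqP ->.
Qed.

Variables (m : nat) (P : V -> 'I_m.+3) (G : sgraph V) (A X : {set V}) (E : {set V * V}).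

Definition nbhd : {set V} := [set u | [exists a in A, adj G a u]].

(** The test for [X] comes first, so an exceptional vertex goes to part 1 even when it lies in
    [nbhd]; all other vertices of [nbhd] go to part 0. *)
Definition part u : 'I_m.+3 :=
  if u \in X then inord 1 else if u \in nbhd then ord0 else P u.

Definition sparse_rel : rel V := fun x y =>
  if x \in A then if y \in A then dadj E x y else part y == ord0
  else if y \in A then part x == ord0 else part x != part y.

Definition sparse_graph := restrict G sparse_rel.

Lemma sparse_relC : symmetric sparse_rel.
Proof.
move=> x y; rewrite /sparse_rel.
by case: (x \in A); case: (y \in A); rewrite // ?(dadjC E x y) // eq_sym.
Qed.

Lemma adj_sparse x y : adj sparse_graph x y = adj G x y && sparse_rel x y.
Proof. exact: adj_restrict sparse_relC. Qed.

Lemma sparse_spanning : spanning_subgraph sparse_graph G.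
Proof. by apply/fintype.subsetP => e; rewrite inE => /andP[]. Qed.

(** Outside [A], a vertex of [A] has neighbours only in part 0, so colours 1 and 2 are free for a
    2-colouring of [E] on [S], and every other vertex takes its part as colour. This takes three
    parts, whence [r] at least 4. *)
Lemma sparse_colourable s :
  locally_bipartite E s -> all_subgraphs_colourable sparse_graph s m.+3.
Proof.
move=> Eb S F Ss FG.
have [c cP] := Eb S (eq_leq Ss).
pose f (x : {x : V | x \in S}) : 'I_m.+3 :=
  if val x \in A then if c (val x) then inord 1 else inord 2 else part (val x).
apply/existsP; exists [ffun x => f x].
apply/forallP => x; apply/forallP => y; apply/implyP => /FG.
rewrite adj_sparse !ffunE /f /sparse_rel => /andP[_].
have n01 : inord 1 != ord0 :> 'I_m.+3 by rewrite -val_eqE /= inordK.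
have n02 : inord 2 != ord0 :> 'I_m.+3 by rewrite -val_eqE /= inordK.
have n12 : inord 1 != inord 2 :> 'I_m.+3 by rewrite -val_eqE /= !inordK.
case: ifP => xA; case: ifP => yA //.
- move/(cP _ _ (valP x) (valP y)).
  by case: (c _); case: (c _) => // _; rewrite eq_sym.
- by move/eqP ->; case: ifP.
- by move/eqP ->; case: ifP => _; rewrite eq_sym.
Qed.

(** Each colour class inside [A] is independent in [E] and so has fewer than [h] vertices; fewer
    than [s] classes cannot cover [A]. *)
Lemma sparse_chi s h :
  0 < h -> s * h <= #|A| -> (forall u v, dadj E u v -> adj G u v) ->
  (forall J, J \in independent_sets E A -> #|J| < h) -> s <= chi sparse_graph.
Proof.
move=> h0 shA EG Ei; rewrite /chi; case: ex_minnP => k /existsP[f /forallP fP] _.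
rewrite leqNgt; apply/negP => ks.
suff : #|A| <= k * h.-1 by move: shA; nia.
rewrite -sum1_card (partition_big f predT) //=.
rewrite -[X in _ <= X * _](card_ord k) -sum_nat_const; apply: leq_sum => i _.
rewrite sum1_card -ltnS prednK //.
rewrite (_ : #|_| = #|[set u in A | f u == i]|); last by apply: eq_card => u; rewrite !inE.
apply: Ei; rewrite inE; apply/andP; split.
  by apply/fintype.subsetP => u; rewrite inE => /andP[].
apply/forall_inP => u; rewrite inE => /andP[uA /eqP fu].
apply/forall_inP => v; rewrite inE => /andP[vA /eqP fv].
apply/negP => uv; move/forallP: (fP u) => /(_ v).
by rewrite adj_sparse (EG _ _ uv) /sparse_rel uA vA uv fu fv eqxx.
Qed.

(** Off [A], [X] and [nbhd] the map [part] agrees with [P], so a vertex loses little besides its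
    neighbours in one class [i] of [P]. A vertex of [A] keeps all its neighbours off [A] and [X]; a
    vertex of [X], being in part 1, keeps those in [nbhd]; any other vertex has at most [d]
    neighbours in [nbhd]. *)
Lemma sparse_degree d v :
  (forall v, v \notin A -> v \notin X -> #|[set u in nbhd | adj G v u]| <= d) ->
  exists i, #|[set u | adj G v u & P u != i]| <= degree sparse_graph v + d + #|X| + #|A|.
Proof.
move=> Xd; set N := [set y | adj sparse_graph v y].
have N_card (B : {set V}) : B \subset N :|: X :|: A -> #|B| <= #|N| + #|X| + #|A|.
  move=> /subset_leq_card BN; apply: leq_trans BN _.
  rewrite cardsU; apply: leq_trans (leq_subr _ _) _; rewrite leq_add2r.
  by rewrite cardsU; apply: leq_trans (leq_subr _ _) _.
have N_part u : adj G v u -> u \notin A -> part u != part v -> v \notin A -> u \in N.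
  by move=> vu uA uv vA; rewrite inE adj_sparse vu /sparse_rel (negbTE vA) (negbTE uA) eq_sym.
case: (boolP (v \in A)) => vA.
  exists ord0; apply: leq_trans (N_card _ _) _; last by rewrite /degree -/N; lia.
  apply/fintype.subsetP => u; rewrite inE => /andP[vu _]; rewrite !finset.in_setU.
  case: (boolP (u \in A)) => uA; rewrite ?orbT //= orbF.
  case: (boolP (u \in X)) => uX; rewrite ?orbT //= orbF.
  rewrite inE adj_sparse vu /sparse_rel vA (negbTE uA) /part (negbTE uX).
  suff -> : u \in nbhd by [].
  by rewrite inE; apply/existsP; exists v; rewrite vA.
case: (boolP (v \in X)) => vX.
  exists (inord 1); apply: leq_trans (N_card _ _) _; last by rewrite /degree -/N; lia.
  apply/fintype.subsetP => u; rewrite inE => /andP[vu Pu]; rewrite !finset.in_setU.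
  case: (boolP (u \in A)) => uA; rewrite ?orbT //= orbF.
  case: (boolP (u \in X)) => uX; rewrite ?orbT //= orbF.
  apply: N_part => //; rewrite /part vX (negbTE uX); case: ifP => // _.
  by rewrite -val_eqE /= inordK.
exists (part v).
apply: (@leq_trans (#|[set u in nbhd | adj G v u]| + (#|N| + #|X| + #|A|))); last first.
  by rewrite /degree -/N; move: (Xd v vA vX); lia.
set C := [set u in nbhd | _]; set D := [set u | _ & _].
have -> : D = (D :&: C) :|: (D :\: C) by rewrite finset.setID.
rewrite cardsU; apply: leq_trans (leq_subr _ _) _; apply: leq_add.
  by rewrite subset_leq_card // finset.subsetIr.
apply: N_card; apply/fintype.subsetP => u; rewrite !inE.
case: (boolP (adj G v u)) => //= vu; rewrite ?andbF // andbT => /andP[uN Pu].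
case: (boolP (u \in A)) => uA; rewrite ?orbT //= orbF.
case: (boolP (u \in X)) => uX; rewrite ?orbT //= orbF.
suff : u \in N by rewrite inE.
apply: N_part => //; rewrite {1}/part (negbTE uX) ifF //.
by apply: negbTE; rewrite inE.
Qed.

End Assembly.

Local Open Scope ring_scope.

(** * Concentration in the random graph *)

Section Expectation.
Variables (R : realType) (n : nat) (p : R).
Hypothesis p01 : 0 <= p <= 1.

Definition expect (f : sgraph 'I_n -> R) : R := \sum_G Gnp_weight p G * f G.

Lemma Gnp_weight_ge0 (G : sgraph 'I_n) : 0 <= Gnp_weight p G.
Proof.
by apply: prodr_ge0 => e _; case: ifP => _; have /andP[? ?] := p01; lra.
Qed.

(** This is independence of the edges: expanding the product of sums gives one term per set of
    edges. *)
Lemma expect_prod (phi : {set 'I_n} -> bool -> R) :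
  expect (fun G => \prod_(e : {set 'I_n} | #|e| == 2%N) phi e (e \in edges G)) =
  \prod_(e : {set 'I_n} | #|e| == 2%N) (p * phi e true + (1 - p) * phi e false).
Proof.
(* The expansion runs over all families of sets of vertices; the values 0 and 1 at sets that are not
   pairs kill every family that is not the edge set of a graph. *)
pose a (e : {set 'I_n}) := if #|e| == 2%N then p * phi e true else 0.
pose b (e : {set 'I_n}) := if #|e| == 2%N then (1 - p) * phi e false else 1.
transitivity (\prod_e (a e + b e)); last first.
  rewrite [RHS]big_mkcond /=; apply: eq_bigr => e _; rewrite /a /b.
  by case: ifP => // _; rewrite add0r.
rewrite bigA_distr /expect.
rewrite (bigID (fun E : {set {set 'I_n}} => [forall e in E, #|e| == 2%N])) /=.
rewrite [X in _ = _ + X]big1 ?addr0; last first.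
  move=> E /forall_inPn[e eE e2]; rewrite (bigD1 e) //= eE.
  by rewrite /a (negbTE e2) mul0r.
rewrite (reindex_omap (@edges 'I_n) insub) /=; last first.
  by move=> E PE; rewrite insubT.
rewrite big_mkcond [RHS]big_mkcond /=; apply: eq_bigr => G _.
rewrite (edgesP G) /= valK eqxx /= /Gnp_weight -big_split /=.
rewrite big_mkcond /=; apply: eq_bigr => e _.
rewrite /a /b; case: ifP => [_|ne2]; first by case: ifP => _; rewrite ?addr0.
by case: ifP => // eG; move: (edgesP G) => /forall_inP/(_ e eG); rewrite ne2.
Qed.

(** For [B] inside [A], the probability that a vertex outside [A] has exactly [B] as its
    neighbourhood in [A]. *)
Definition wt (A B : {set 'I_n}) : R := \prod_(a in A) (if a \in B then p else 1 - p).

Lemma wt_ge0 A B : 0 <= wt A B.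
Proof. by apply: prodr_ge0 => a _; have /andP[? ?] := p01; case: ifP => _; lra. Qed.

Lemma expect_cylinder (A Y : {set 'I_n}) (f : 'I_n -> {set 'I_n}) :
  [disjoint A & Y] ->
  expect (fun G => \prod_(y in Y) \prod_(a in A) (adj G a y == (a \in f y))%:R) =
  \prod_(y in Y) wt A (f y).
Proof.
move=> dAY.
pose pr := [pred ya : 'I_n * 'I_n | (ya.1 \in Y) && (ya.2 \in A)].
pose ed (ya : 'I_n * 'I_n) := [set ya.2; ya.1].
have ed2 ya : pr ya -> #|ed ya| == 2%N.
  case/andP=> yY aA; rewrite cards2; case: (ya.2 =P ya.1) => //= e.
  by move: (disjointFr dAY aA); rewrite e yY.
have ed_inj ya yb : pr ya -> pr yb -> ed ya = ed yb -> ya = yb.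
  case: ya yb => [y a] [y' a'] /andP[/= yY aA] /andP[/= yY' aA'].
  rewrite /ed /= => /setP e.
  have := e a; rewrite !inE eqxx /= => /esym/orP[/eqP ->|/eqP ay]; last first.
    by move: (disjointFr dAY aA); rewrite ay yY'.
  have := e y; rewrite !inE eqxx orbT => /esym/orP[/eqP ya|/eqP -> //].
  by move: (disjointFr dAY aA'); rewrite -ya yY.
(* Since [A] and [Y] are disjoint, a pair [e] comes from at most one [(y, a)], so [phi e] is a
   single indicator or the empty product 1. *)
pose phi e (c : bool) : R :=
  \prod_(ya | pr ya && (ed ya == e)) (c == (ya.2 \in f ya.1))%:R.
transitivity (expect (fun G =>
    \prod_(e : {set 'I_n} | #|e| == 2%N) phi e (e \in edges G))).
  apply: eq_bigr => G _; congr (_ * _); rewrite pair_big /=.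
  rewrite (partition_big ed (fun e => #|e| == 2%N)) //=.
  apply: eq_bigr => e _; apply: eq_bigr => ya /andP[_ /eqP <-].
  by rewrite /adj.
rewrite expect_prod /wt pair_big /= (partition_big ed (fun e => #|e| == 2%N)) //=.
apply: eq_bigr => e _; rewrite /phi.
case: (pickP (fun ya => pr ya && (ed ya == e))) => [yb /andP[pb /eqP be]|no].
  have fib : (fun ya => pr ya && (ed ya == e)) =1 pred1 yb.
    move=> ya; apply/andP/eqP => [[pa /eqP ae]|->]; last by rewrite be.
    by apply: ed_inj => //; rewrite ae.
  rewrite !(eq_bigl _ _ fib) !big_pred1_eq.
  by case: (_ \in _); rewrite /= ?mulr1 ?mulr0 ?addr0 ?add0r.
by rewrite !(eq_bigl _ _ no) !big_pred0_eq !mulr1 addrC subrK.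
Qed.

(** The neighbourhoods in [A] of the vertices of [Y] are independent with law [wt A]: distribute the
    right side over all families of subsets and use the cylinder probabilities. *)
Lemma expect_nbrs (A Y : {set 'I_n}) (g : 'I_n -> {set 'I_n} -> R) :
  [disjoint A & Y] ->
  expect (fun G => \prod_(y in Y) g y (nbrs G A y)) =
  \prod_(y in Y) \sum_(B : {set 'I_n} | B \subset A) wt A B * g y B.
Proof.
move=> dAY.
rewrite (big_distr_big_dep finset.set0) /=.
under eq_bigr => f fP do rewrite big_split /= -expect_cylinder // mulr_suml.
rewrite exchange_big /=; apply: eq_bigr => G _.
under [RHS]eq_bigr => f _ do rewrite -mulrA.
rewrite -mulr_sumr; congr (_ * _).
(* A graph lies in exactly one cylinder, that of [f0]; the value outside [Y] is the default imposed
   by the distributivity lemma. *)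
pose f0 : {ffun 'I_n -> {set 'I_n}} :=
  [ffun y => if y \in Y then nbrs G A y else finset.set0].
rewrite (bigD1 f0) /=; last first.
  apply/pfamilyP; split.
    by apply/supportP => y yY; rewrite ffunE (negbTE yY).
  move=> y yY; rewrite ffunE yY unfold_in.
  by apply/fintype.subsetP => a; rewrite inE => /andP[].
rewrite [X in _ = _ + X]big1 ?addr0.
  rewrite [X in _ = X * _]big1 ?mul1r; last first.
    move=> y yY; apply: big1 => a aA; rewrite ffunE yY inE aA /=.
    by rewrite eqxx.
  by apply: eq_bigr => y yY; rewrite ffunE yY.
move=> f /andP[/pfamilyP[fY fA] ff0].
suff /exists_inP[y yY /exists_inP[a aA ne]] :
    [exists y in Y, [exists a in A, adj G a y != (a \in f y)]].
  by rewrite (bigD1 y) //= (bigD1 a) //= (negbTE ne) !mul0r.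
apply: contraNT ff0; rewrite negb_exists_in => /forall_inP H.
apply/eqP/ffunP => y; rewrite ffunE; case: ifP => yY; last first.
  by move/supportP: fY => -> //; rewrite yY.
apply/setP => a; rewrite inE.
have := H y yY; rewrite negb_exists_in => /forall_inP/(_ a).
case: (boolP (a \in A)) => [_ /(_ isT)/negPn/eqP -> //|aA _].
apply: contraNF aA; apply: fintype.subsetP; exact: fA.
Qed.

Lemma sum_subset_prod (A : {set 'I_n}) (x y : R) :
  \sum_(B : {set 'I_n} | B \subset A) \prod_(a in A) (if a \in B then x else y) =
  (x + y) ^+ #|A|.
Proof.
pose a i := if i \in A then x else 0.
pose b i := if i \in A then y else 1.
transitivity (\prod_i (a i + b i)); last first.
  rewrite -prodr_const [RHS]big_mkcond /=; apply: eq_bigr => i _.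
  by rewrite /a /b; case: ifP => _; rewrite ?add0r.
rewrite bigA_distr [RHS](bigID (fun B : {set 'I_n} => B \subset A)) /=.
rewrite [X in _ = _ + X]big1 ?addr0; last first.
  by move=> B /subsetPn[i iB iA]; rewrite (bigD1 i) //= iB /a (negbTE iA) mul0r.
apply: eq_bigr => B BA; rewrite big_mkcond; apply: eq_bigr => i _.
rewrite /a /b; case: (boolP (i \in A)) => // iA; case: ifP => // iB.
by move: iA; rewrite (fintype.subsetP BA).
Qed.

Lemma sum_wt (A : {set 'I_n}) : \sum_(B : {set 'I_n} | B \subset A) wt A B = 1.
Proof. by rewrite sum_subset_prod addrC subrK expr1n. Qed.

Lemma wt_uniform (A B : {set 'I_n}) :
  B \subset A -> wt A B = p ^+ #|B| * (1 - p) ^+ (#|A| - #|B|).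
Proof.
move=> BA; rewrite /wt (bigID (mem B)) /= -cardsDS //.
congr (_ * _); rewrite -prodr_const; apply: eq_big.
- by move=> a; rewrite andb_idl // => /(fintype.subsetP BA).
- by move=> a /andP[_ ->].
- by move=> a; rewrite inE andbC.
- by move=> a /andP[_ /negbTE ->].
Qed.

Lemma expect1 : expect (fun=> 1) = 1.
Proof.
have := expect_prod (fun _ _ => 1); rewrite [RHS]big1 => [E|e _].
  by rewrite -[RHS]E; apply: eq_bigr => G _; rewrite big1_eq.
by rewrite !mulr1 addrC subrK.
Qed.

Lemma le_expect f g : (forall G, f G <= g G) -> expect f <= expect g.
Proof. by move=> fg; apply: ler_sum => G _; rewrite ler_wpM2l ?Gnp_weight_ge0. Qed.

Definition prob (P : pred (sgraph 'I_n)) : R := expect (fun G => (P G)%:R).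

Lemma prob_le_expect (P : pred (sgraph 'I_n)) f :
  (forall G, 0 <= f G) -> (forall G, P G -> 1 <= f G) -> prob P <= expect f.
Proof.
by move=> f0 f1; apply: le_expect => G; case: (boolP (P G)) => // /f1.
Qed.

Lemma le_prob (P Q : pred (sgraph 'I_n)) :
  (forall G, P G -> Q G) -> prob P <= prob Q.
Proof. by move=> PQ; apply: prob_le_expect => // G /PQ ->. Qed.

Lemma prob_exists (T : finType) (S : pred T) (P : T -> pred (sgraph 'I_n)) :
  prob (fun G => [exists t in S, P t G]) <= \sum_(t in S) prob (P t).
Proof.
rewrite /prob /expect exchange_big /= -/(expect _).
under eq_bigr => G _ do rewrite -mulr_sumr.
apply: prob_le_expect => [G|G /exists_inP[t tS PtG]].
  exact: sumr_ge0.
by rewrite (bigD1 t) //= PtG lerDl sumr_ge0.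
Qed.

Lemma prob_exists_le (T : finType) (S : pred T) (P : T -> pred (sgraph 'I_n)) c :
  (forall t, t \in S -> prob (P t) <= c) ->
  prob (fun G => [exists t in S, P t G]) <= #|S|%:R * c.
Proof.
move=> Pc; apply: le_trans (prob_exists _ _) _.
by apply: le_trans (ler_sum _ Pc) _; rewrite sumr_const mulr_natl.
Qed.

Lemma prob_or (P Q : pred (sgraph 'I_n)) :
  prob (fun G => P G || Q G) <= prob P + prob Q.
Proof.
rewrite /prob /expect -big_split /=; apply: ler_sum => G _.
rewrite -mulrDr ler_wpM2l ?Gnp_weight_ge0 //.
by case: (P G); case: (Q G); rewrite //= ?add0r ?addr0 // lerDl.
Qed.

Lemma Gnp_prob_ge (P : pred (sgraph 'I_n)) (A : set (sgraph 'I_n)) :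
  (forall G, ~~ P G -> A G) -> 1 - prob P <= Gnp_prob p A.
Proof.
move=> PA; rewrite -expect1 /prob /expect -sumrB /Gnp_prob big_mkcond /=.
rewrite [leRHS]big_mkcond /=; apply: ler_sum => G _.
rewrite mulr1; case: ifPn => [_|].
  by rewrite lerBlDl lerDr mulr_ge0 // Gnp_weight_ge0.
rewrite notin_setE => nA; case: (boolP (P G)) => [_|/PA //].
by rewrite mulr1 subrr.
Qed.

Lemma exprD1_le_expR (x : R) k : 0 <= 1 + x -> (1 + x) ^+ k <= expR (x * k%:R).
Proof.
move=> x1; by rewrite expRM_natr lerXn2r ?nnegrE ?expR_ge0 ?expR_ge1Dx.
Qed.

(** Exponential moment of the number of edges between [A] and [Y]: every pair contributes a factor
    [1 + p * (expR t - 1)], and [1 + x <= expR x]. *)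
Lemma expect_exp_degrees (A Y : {set 'I_n}) (t : R) : [disjoint A & Y] ->
  expect (fun G => expR (t * (\sum_(y in Y) #|nbrs G A y|)%:R)) <=
  expR (p * (expR t - 1) * (#|A| * #|Y|)%:R).
Proof.
move=> dAY; have /andP[p0 p1] := p01.
pose g (_ : 'I_n) (B : {set 'I_n}) : R := expR (t * #|B|%:R).
have -> : expect (fun G => expR (t * (\sum_(y in Y) #|nbrs G A y|)%:R)) =
    expect (fun G => \prod_(y in Y) g y (nbrs G A y)).
  apply: eq_bigr => G _; rewrite natr_sum mulr_sumr.
  by rewrite (big_morph _ (@expRD R) (@expR0 R)).
rewrite expect_nbrs //.
have gA y : \sum_(B : {set 'I_n} | B \subset A) wt A B * g y B =
    (1 + p * (expR t - 1)) ^+ #|A|.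
  rewrite (_ : 1 + _ = p * expR t + (1 - p)); last by ring.
  rewrite -sum_subset_prod; apply: eq_bigr => B BA.
  rewrite /g mulrC expRM_natr -prodr_const /wt.
  rewrite [X in _ * X](bigID (mem B)) [RHS](bigID (mem B)) /=.
  rewrite [X in _ * (X * _) = _](_ : _ = \prod_(a in B) p).
    rewrite mulrA -big_split /=; congr (_ * _); last first.
      by apply: eq_bigr => a /andP[_ /negbTE ->].
    apply: eq_big => [a|a aB]; last by rewrite aB mulrC.
    by rewrite andb_idl // => /(fintype.subsetP BA).
  apply: eq_big => [a|a /andP[_ ->] //].
  by rewrite andb_idl // => /(fintype.subsetP BA).
under eq_bigr => y _ do rewrite gA.
rewrite prodr_const -exprM; apply: exprD1_le_expR.
by have := expR_ge0 t; nra.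
Qed.

Lemma expect_exp_count (A Y : {set 'I_n}) (KK : {set {set 'I_n}}) (mu t : R) :
  [disjoint A & Y] ->
  (forall B, B \in KK -> B \subset A) ->
  \sum_(B in KK) wt A B = mu ->
  expect (fun G => expR (t * #|[set y in Y | nbrs G A y \in KK]|%:R)) <=
  expR (mu * (expR t - 1) * #|Y|%:R).
Proof.
move=> dAY KA muE.
pose g (_ : 'I_n) (B : {set 'I_n}) : R := expR (t * (B \in KK)%:R).
have -> : expect (fun G => expR (t * #|[set y in Y | nbrs G A y \in KK]|%:R)) =
    expect (fun G => \prod_(y in Y) g y (nbrs G A y)).
  apply: eq_bigr => G _; rewrite -sum1_card natr_sum mulr_sumr.
  rewrite (big_morph _ (@expRD R) (@expR0 R)) big_mkcond [in RHS]big_mkcond /=.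
  congr (_ * _); apply: eq_bigr => y _; rewrite inE /g.
  by case: (y \in Y); case: (_ \in KK); rewrite ?mulr0 ?expR0.
rewrite expect_nbrs //.
(* Together with [0 <= mu] this keeps [1 + mu * (expR t - 1)] nonnegative also for negative [t]. *)
have mu1 : mu <= 1.
  rewrite -(sum_wt A) -muE [leRHS](bigID (fun B : {set 'I_n} => B \in KK)) /=.
  rewrite (eq_bigl (fun B : {set 'I_n} => (B \subset A) && (B \in KK))) => [|B].
    by rewrite lerDl sumr_ge0 // => B _; exact: wt_ge0.
  by rewrite andb_idl // => /KA.
have mu0 : 0 <= mu by rewrite -muE sumr_ge0 // => B _; exact: wt_ge0.
have gA y : \sum_(B : {set 'I_n} | B \subset A) wt A B * g y B =
    1 + mu * (expR t - 1).
  rewrite -{1}(sum_wt A) -muE mulr_suml.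
  rewrite [X in _ = _ + X](eq_bigl (fun B : {set 'I_n} => (B \subset A) && (B \in KK))); last first.
    by move=> B; rewrite andb_idl // => /KA.
  rewrite [X in _ = _ + X]big_mkcondr -big_split /=; apply: eq_bigr => B _.
  by rewrite /g; case: (B \in KK); rewrite ?mulr1 ?mulr0 ?expR0; ring.
under eq_bigr => y _ do rewrite gA.
rewrite prodr_const; apply: exprD1_le_expR.
by have := expR_ge0 t; nra.
Qed.

End Expectation.

Lemma adj_irrefl (V : finType) (G : sgraph V) v : adj G v v = false.
Proof.
apply/negP; rewrite /adj finset.setUid => /(forall_inP (edgesP G)).
by rewrite cards1.
Qed.

(** Such a set is listed by a function from ['I_k] to [option T], padded with [None]. *)
Lemma card_small_sets (T : finType) k :
  (#|[set S : {set T} | #|S| <= k]| <= #|T|.+1 ^ k)%N.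
Proof.
pose dec (f : {ffun 'I_k -> option T}) := [set x | Some x \in codom f].
rewrite -card_option -[X in (_ <= _ ^ X)%N](card_ord k) -card_ffun -cardsT.
apply: leq_trans (leq_imset_card dec _).
apply/subset_leq_card/fintype.subsetP => S; rewrite inE => Sk.
apply/imsetP; exists [ffun i : 'I_k => nth None (map Some (enum S)) i] => //.
apply/setP => x; rewrite inE; apply/idP/codomP => [xS|[i]]; last first.
  rewrite ffunE => /esym/eqP xi.
  have iS : (i < size (map Some (enum S)))%N.
    by rewrite ltnNge; apply/negP => /(nth_default None) e; rewrite e in xi.
  have := mem_nth None iS; rewrite (eqP xi) => /mapP[x' + [->]].
  by rewrite mem_enum.
have xi : (index x (enum S) < #|S|)%N by rewrite cardE index_mem mem_enum.
exists (Ordinal (leq_trans xi Sk)); rewrite ffunE /=.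
by rewrite (nth_map x) ?nth_index ?mem_enum // -cardE.
Qed.

(** * Exponential inequalities and tail bounds *)

Section Exponentials.
Variable R : realType.

(** From [1 + x <= expR x] and the identity [(1 - x + x ^+ 2) * (1 + x) = 1 + x ^+ 3]. *)
Lemma expRN_le (x : R) : 0 <= x -> expR (- x) <= 1 - x + x ^+ 2.
Proof.
move=> x0; rewrite expRN -[leLHS]mul1r ler_pdivrMr ?expR_gt0 //.
have := expR_ge1Dx x; have : 0 <= x ^+ 3 by rewrite exprn_ge0.
rewrite !exprS expr0 mulr1 => x3 ex; nra.
Qed.

Lemma expR_half : expR (2^-1 : R) <= 2.
Proof.
have := expRN_le (_ : 0 <= (2^-1 : R)); rewrite expRN => /(_ ltac:(lra)) h.
have e0 := expR_gt0 (2^-1 : R).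
have := expR_ge1Dx (- (2^-1 : R)); rewrite expRN => h'.
have : 2^-1 <= (expR (2^-1 : R))^-1 by lra.
by rewrite lef_pV2 // posrE.
Qed.

Lemma expR1_le : expR (1 : R) <= 4.
Proof.
rewrite (_ : 1 = 2^-1 + 2^-1 :> R); last by lra.
by rewrite expRD; have := expR_half; have := expR_gt0 (2^-1 : R); nra.
Qed.

Lemma expRN1_le : expR (- 1 : R) <= 2^-1.
Proof.
rewrite expRN lef_pV2 ?posrE ?expR_gt0 //.
by have := expR_ge1Dx (1 : R); lra.
Qed.

End Exponentials.

Section Tails.
Variables (R : realType) (n : nat) (p : R).
Hypothesis p01 : 0 <= p <= 1.
Implicit Types (A B X Y Z : {set 'I_n}).

Let p0 : 0 <= p. Proof. by case/andP: p01. Qed.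

(** Markov's inequality for [expR (t * f G)]; the sign of [t] is free, so both tails are covered. *)
Lemma prob_chernoff (P : pred (sgraph 'I_n)) (f : sgraph 'I_n -> R) (t c b : R) :
  (forall G, P G -> t * c <= t * f G) ->
  expect p (fun G => expR (t * f G)) <= expR b -> prob p P <= expR (b - t * c).
Proof.
move=> Pf fb; apply: (@le_trans _ _ (expect p (fun G => expR (t * f G) * expR (- (t * c))))).
  apply: prob_le_expect => // G /=.
  by move=> /Pf tc; rewrite -expRD; apply: le_trans (expR_ge1Dx _); lra.
rewrite expRD /expect; under eq_bigr => G _ do rewrite mulrA.
by rewrite -mulr_suml ler_wpM2r ?expR_ge0.
Qed.

Lemma sum_nbrs1 (G : sgraph 'I_n) v Y :
  (\sum_(y in Y) #|nbrs G [set v] y|)%N = #|[set y in Y | adj G v y]|.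
Proof.
rewrite -sum1_card big_mkcond [RHS]big_mkcond /=; apply: eq_bigr => y _.
rewrite inE; case: (y \in Y) => //=; case: ifP => vy.
  rewrite (_ : nbrs _ _ _ = [set v]) ?cards1 //; apply/setP => u; rewrite !inE.
  by case: eqP => [->|//].
rewrite (_ : nbrs _ _ _ = finset.set0) ?cards0 //; apply/setP => u; rewrite !inE.
by case: eqP => [->|//].
Qed.

Lemma card_adj_setD1 (G : sgraph 'I_n) v Z :
  #|[set y in Z :\ v | adj G v y]| = #|[set y in Z | adj G v y]|.
Proof.
apply: eq_card => y; rewrite !inE; case: eqP => [->|//].
by rewrite adj_irrefl !andbF.
Qed.

Lemma prob_degree_low v Z (d : R) : 0 <= d -> 
  prob p (fun G => #|[set y in Z | adj G v y]|%:R < (1 - d) * p * #|Z :\ v|%:R) <=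
  expR (- (d ^+ 2 / 4) * p * #|Z :\ v|%:R).
Proof.
move=> d0; set M := #|Z :\ v|%:R; have M0 : 0 <= M :> R by rewrite ler0n.
have dj : [disjoint [set v] & Z :\ v] by rewrite disjoints1 !inE eqxx.
have E := expect_exp_degrees p01 (- (d / 2)) dj.
(* The exponent per unit of [p * M] is at most [- d / 2 + d ^+ 2 / 4 + (d / 2) * (1 - d)], which is
   [- d ^+ 2 / 4]. *)
apply: le_trans (prob_chernoff (t := - (d / 2)) (c := (1 - d) * p * M) _ E) _.
  move=> G /ltW h; rewrite sum_nbrs1 card_adj_setD1 !mulNr lerN2 ler_wpM2l //.
  by rewrite divr_ge0.
rewrite ler_expR cards1 mul1n -/M.
have := expRN_le (_ : 0 <= d / 2); move=> /(_ ltac:(lra)) e.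
have : 0 <= p * M by rewrite mulr_ge0.
nra.
Qed.

Lemma prob_degree_high (v : 'I_n) :
  prob p (fun G => 4 * p * n%:R < #|[set y | adj G v y]|%:R) <= expR (- (p * n%:R)).
Proof.
have dj : [disjoint [set v] & [set: 'I_n] :\ v] by rewrite disjoints1 !inE eqxx.
have E := expect_exp_degrees p01 (2^-1) dj.
apply: le_trans (prob_chernoff (t := 2^-1) (c := 4 * p * n%:R) _ E) _.
  move=> G /ltW h; rewrite sum_nbrs1 card_adj_setD1 ler_wpM2l ?invr_ge0 //.
  apply: le_trans h _; rewrite ler_nat subset_leq_card //.
  by apply/fintype.subsetP => y; rewrite !inE.
rewrite ler_expR cards1 mul1n.
have M : #|[set: 'I_n] :\ v|%:R <= n%:R :> R.
  by rewrite ler_nat -[leqRHS]card_ord; exact: max_card.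
have pM : p * #|[set: 'I_n] :\ v|%:R <= p * n%:R by rewrite ler_wpM2l.
move: pM (mulr_ge0 p0 (ler0n R #|[set: 'I_n] :\ v|)) (expR_half R).
move: (#|_ :\ v|%:R) (expR _) => x e; clear; nra.
Qed.

Lemma prob_edges_between X Y (c : R) : [disjoint X & Y] ->
  prob p (fun G => c <= (\sum_(y in Y) #|nbrs G X y|)%:R) <=
  expR (3 * p * (#|X| * #|Y|)%:R - c).
Proof.
move=> dj; have E := expect_exp_degrees p01 1 dj.
apply: le_trans (prob_chernoff (t := 1) (c := c) _ E) _.
  by move=> G; rewrite !mul1r.
rewrite ler_expR mul1r lerD2r.
have XY : 0 <= p * (#|X| * #|Y|)%:R by rewrite mulr_ge0.
move: XY (expR1_le R); move: (_%:R) (expR 1) => x e; clear; nra.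
Qed.

Lemma sum_wt_uniform A (KK : {set {set 'I_n}}) K :
  (forall B, B \in KK -> (B \subset A) /\ #|B| = K) ->
  \sum_(B in KK) wt p A B = #|KK|%:R * (p ^+ K * (1 - p) ^+ (#|A| - K)).
Proof.
move=> KKP; rewrite mulr_natl -sumr_const; apply: eq_bigr => B /KKP[BA BK].
by rewrite wt_uniform // BK.
Qed.

Definition hits (G : sgraph 'I_n) A (KK : {set {set 'I_n}}) : {set 'I_n} :=
  [set y in ~: A | nbrs G A y \in KK].

(** With [N] vertices outside [A], failure forces at most [mu * N / 4] hits of [KK] or at least
    [mu * N / (4 * lam)] hits of [KI]. The latter have mean at most [mu * N / (24 * lam)], and
    [expR 1 - 1 <= 3] then leaves [mu * N / (8 * lam)] in the exponent. *)
Lemma prob_hits A (KK KI : {set {set 'I_n}}) K lam (mu : R) :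
  (forall B, B \in KK -> (B \subset A) /\ #|B| = K) -> KI \subset KK ->
  (0 < lam)%N -> (24 * lam * #|KI| <= #|KK|)%N ->
  mu = #|KK|%:R * (p ^+ K * (1 - p) ^+ (#|A| - K)) ->
  prob p (fun G => (#|hits G A KK| == 0%N) || (#|hits G A KK| < lam * #|hits G A KI|)%N)
  <= 2 * expR (- (mu * #|~: A|%:R / (8 * lam%:R))).
Proof.
move=> KKP KIKK lam0 card_KI muE.
have p1 : p <= 1 by case/andP: p01.
have w0 : 0 <= p ^+ K * (1 - p) ^+ (#|A| - K) by rewrite mulr_ge0 ?exprn_ge0 ?subr_ge0.
have dj : [disjoint A & ~: A] by rewrite -finset.setI_eq0 finset.setICr.
have E1 := expect_exp_count p01 (-1) dj (fun B BK => (KKP B BK).1) (sum_wt_uniform KKP).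
have KIP B : B \in KI -> (B \subset A) /\ #|B| = K by move/(fintype.subsetP KIKK)/KKP.
have E2 := expect_exp_count p01 1 dj (fun B BK => (KIP B BK).1) (sum_wt_uniform KIP).
rewrite -muE in E1; set muI := _ * (_ * _) in E2.
set N : R := #|~: A|%:R in E1 E2 *; have N0 : 0 <= N by exact: ler0n.
have l1 : 1 <= lam%:R :> R by rewrite ler1n.
have mu0 : 0 <= mu by rewrite muE mulr_ge0.
have muI0 : 0 <= muI by rewrite mulr_ge0.
have muI_le : 24 * lam%:R * muI <= mu.
  by rewrite /muI muE mulrA ler_wpM2r // -!natrM ler_nat.
have L0 : 0 < 8 * lam%:R :> R by lra.
pose P1 G := (#|hits G A KK|%:R <= mu * N / 4).
pose P2 G := (mu * N / (4 * lam%:R) <= #|hits G A KI|%:R).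
apply: (@le_trans _ _ (prob p (fun G => P1 G || P2 G))).
  apply: le_prob => // G /orP[/eqP e|h].
    by rewrite /P1 e divr_ge0 // mulr_ge0.
  case: (boolP (P1 G)) => //=; rewrite /P1 /P2 -ltNge => h1.
  rewrite ler_pdivrMr; last by lra.
  have : #|hits G A KK|%:R < lam%:R * #|hits G A KI|%:R :> R by rewrite -natrM ltr_nat.
  nra.
apply: le_trans (prob_or p01 _ _) _.
rewrite mulr_natl mulr2n; apply: lerD.
  apply: le_trans (prob_chernoff (t := -1) (c := mu * N / 4) _ E1) _.
    by move=> G h; rewrite !mulN1r lerN2.
  rewrite ler_expR; have e := expRN1_le R.
  have X : mu * N / (8 * lam%:R) <= mu * N / 4.
    rewrite ler_wpM2l ?mulr_ge0 // lef_pV2 ?posrE //; lra.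
  have := mulr_ge0 mu0 N0; nra.
apply: le_trans (prob_chernoff (t := 1) (c := mu * N / (4 * lam%:R)) _ E2) _.
  by move=> G h; rewrite !mul1r.
rewrite ler_expR mul1r.
have -> : mu * N / (4 * lam%:R) = 2 * (mu * N / (8 * lam%:R)) by field; lra.
suff : muI * (expR 1 - 1) * N <= mu * N / (8 * lam%:R) by lra.
rewrite ler_pdivlMr //; have := expR1_le R => e1.
have : muI * (expR 1 - 1) * (8 * lam%:R) <= mu.
  apply: le_trans muI_le.
  have := mulr_ge0 muI0 (ltW (lt_le_trans ltr01 l1)); nra.
nra.
Qed.

End Tails.

(** * The subgraph from typical properties of the random graph *)

Lemma le_min_degree (R : realType) (V : finType) (G : sgraph V) (b : R) :
  b <= #|V|%:R -> (forall x, b <= (degree G x)%:R) -> b <= (min_degree G)%:R.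
Proof.
move=> bV bG; rewrite /min_degree.
apply: (big_ind (fun k => b <= k%:R)) => // x y bx by_.
by rewrite /minn; case: ifP.
Qed.

Lemma double_count_adj (V : finType) (G : sgraph V) (X Y : {set V}) :
  (\sum_(y in Y) #|nbrs G X y| = \sum_(v in X) #|[set y in Y | adj G v y]|)%N.
Proof.
under eq_bigr => y _ do rewrite -sum1_card.
under [RHS]eq_bigr => y _ do rewrite -sum1_card.
rewrite !pair_big_dep /= (reindex_inj (h := fun z : V * V => (z.2, z.1))) /=; last first.
  by move=> [a b] [c d] [-> ->].
by apply: eq_bigl => -[a b]; rewrite /= !inE andbCA.
Qed.

Definition residue n m (u : 'I_n) : 'I_m.+1 := inord (u %% m.+1).

Lemma card_residue n m (i : 'I_m.+1) :
  (#|[set u : 'I_n | residue m u == i]| <= (n %/ m.+1).+1)%N.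
Proof.
have lt (u : 'I_n) : (u %/ m.+1 < (n %/ m.+1).+1)%N.
  by rewrite ltnS leq_div2r // ltnW.
rewrite -[leqRHS]card_ord; apply: (@leq_card_in _ _ (fun u => Ordinal (lt u))) => //.
move=> u v; rewrite !inE => /eqP ui /eqP vi [uv]; apply: val_inj => /=.
rewrite (divn_eq u m.+1) (divn_eq v m.+1) uv; congr (_ + _)%N.
have := congr1 val (etrans ui (esym vi)).
by rewrite /residue /= !inordK // ltn_pmod.
Qed.

Lemma card_nonresidue (R : realType) n m (v : 'I_n) (i : 'I_m.+1) :
  n%:R * (m%:R / m.+1%:R) - 2 <=
  #|[set u : 'I_n | residue m u != i] :\ v|%:R :> R.
Proof.
pose Z := [set u : 'I_n | residue m u == i].
have : (n <= #|[set u : 'I_n | residue m u != i] :\ v| + #|Z| + 1)%N.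
  rewrite -[leqLHS]card_ord -cardsT -(cards1 v).
  have -> : [set: 'I_n] = [set u : 'I_n | residue m u != i] :\ v :|: Z :|: [set v].
    apply/setP => u; rewrite !inE; case: (u =P v) => _; rewrite ?orbT ?orbF //=.
    by rewrite orbC orbN.
  rewrite cardsU; apply: leq_trans (leq_subr _ _) _; rewrite leq_add2r.
  by rewrite cardsU; apply: leq_trans (leq_subr _ _) _.
have := card_residue n i; rewrite -/Z => h1 h2.
have h3 : (n <= #|[set u : 'I_n | residue m u != i] :\ v| + (n %/ m.+1) + 2)%N by lia.
have h4 : (n %/ m.+1)%:R <= n%:R / m.+1%:R :> R.
  by rewrite ler_pdivlMr // -natrM ler_nat leq_trunc_div.
have h5 : n%:R <= #|[set u : 'I_n | residue m u != i] :\ v|%:R + (n %/ m.+1)%:R + 2 :> R.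
  by rewrite -!natrD ler_nat.
have -> : n%:R * (m%:R / m.+1%:R) = n%:R - n%:R / m.+1%:R :> R.
  by rewrite -natr1; field; rewrite natr1 pnatr_eq0.
rewrite !lerBlDr; apply: le_trans h5 _.
by rewrite addrAC lerD2l.
Qed.

Section Existence.
Variables (R : realType) (n m s : nat) (q gam : R) (G : sgraph 'I_n).
Variables (K D g lam x : nat).

Definition small_degree (d : R) (v : 'I_n) (i : 'I_m.+3) : bool :=
  #|[set y in [set u : 'I_n | residue m.+2 u != i] | adj G v y]|%:R <
  (1 - d) * q * #|[set u : 'I_n | residue m.+2 u != i] :\ v|%:R.

Definition large_degree (v : 'I_n) : bool := 4 * q * n%:R < #|[set y | adj G v y]|%:R.

Definition dense_pair (X Y : {set 'I_n}) (c : R) : bool :=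
  c <= (\sum_(y in Y) #|nbrs G X y|)%:R.

(** Failure of the greedy step in the state [(A, E)]: there is no candidate, or more than a
    proportion [1 / lam] of the candidates misses [I]. *)
Definition bad_config (A I : {set 'I_n}) (E : {set 'I_n * 'I_n}) : bool :=
  let KK := good_sets E s D K A in
  (#|hits G A KK| == 0%N) ||
  (#|hits G A KK| < lam * #|hits G A [set B in KK | [disjoint B & I]]|)%N.

Definition config (A I : {set 'I_n}) (E : {set 'I_n * 'I_n}) : bool :=
  [&& 4 * g <= #|A| <= 8 * s * g, #|E| <= K * #|A|, [forall w, #|dnbrs E w| <= D],
      I \subset A & 4 * g <= #|I|]%N.

(** The deterministic part. The greedy construction runs with [h = 4 * g] and [L = 8 * s * g], so
    independent sets in [A] have fewer than [8 * g] vertices and at least [s] colours are needed. *)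
Lemma exists_sparse_subgraph (d1 g1 eps : R) t :
  (0 < g)%N -> (0 < s)%N -> (K <= D)%N -> (4 * g <= n)%N -> (t <= s)%N ->
  (64 ^ s < lam)%N -> 0 <= q -> 0 <= g1 ->
  (8 * s * g)%:R * q <= eps ->
  2 * x%:R <= g1 * q * n%:R ->
  (forall N : R, n%:R * (m.+2%:R / m.+3%:R) - 2 <= N ->
     (m.+2%:R / m.+3%:R - gam) * q * n%:R <=
     (1 - d1) * q * N - g1 * q * n%:R - x%:R - (8 * s * g)%:R) ->
  (m.+2%:R / m.+3%:R - gam) * q * n%:R <= n%:R ->
  (forall v i, ~~ small_degree d1 v i) ->
  (forall v, ~~ large_degree v) ->
  (forall X Y : {set 'I_n}, [disjoint X & Y] -> #|X| = x -> #|Y|%:R <= 4 * eps * n%:R ->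
     ~~ dense_pair X Y (g1 / 2 * q * n%:R * x%:R)) ->
  (forall A I E, config A I E -> ~~ bad_config A I E) ->
  exists F : sgraph 'I_n, [/\ spanning_subgraph F G, (t <= chi F)%N,
    (m.+2%:R / m.+3%:R - gam) * q * n%:R <= (min_degree F)%:R
    & all_subgraphs_colourable F t m.+3].
Proof.
move=> g0 s0 KD gn ts lam64 q0 g10 Lq xq degN degn Hlow Hhigh Hdense Hconf.
have [A [E [AL EG Eb Ei]]] : exists (A : {set 'I_n}) E, [/\ #|A| = (8 * s * g)%N,
    forall u v, dadj E u v -> adj G u v,
    locally_bipartite E s & forall J, J \in independent_sets E A -> (#|J| < 2 * (4 * g))%N].
  apply: (locally_bipartite_no_large_independent (K := K) (D := D) (lam := lam)) => //.
  - by rewrite muln_gt0.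
  - by rewrite leq_mul2r; apply/orP; right; lia.
  - by rewrite card_ord.
  (* With [h = 4 * g] this gives [8 ^ L = (64 ^ s) ^ h], which is why [lam] must exceed [64 ^ s]. *)
  - rewrite (_ : 8 * s * g = 2 * s * (4 * g))%N; last by lia.
    by rewrite (expnM 8 (2 * s)) ltn_exp2r ?muln_gt0 // (expnM 8 2).
  move=> A E hA AL EA EK degD Q.
  have ok (I : {set 'I_n}) : I \subset A -> (4 * g <= #|I|)%N -> ~~ bad_config A I E.
    by move=> IA hI; apply: Hconf; rewrite /config hA (ltnW AL) EK IA hI !andbT; apply/forallP.
  split.
    by have := ok A (fintype.subxx _) hA; rewrite negb_or lt0n => /andP[].
  move=> I IA hI; have := ok I IA hI; rewrite negb_or -leqNgt => /andP[_].
  apply: leq_trans; rewrite leq_mul2l; apply/orP; right.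
  apply/subset_leq_card/fintype.subsetP => y; rewrite /Q !inE.
  by move=> /andP[/andP[-> ->] ->].
pose N := nbhd G A.
pose X := [set v in ~: A | g1 * q * n%:R < #|[set u in N | adj G v u]|%:R].
have N_le : #|N|%:R <= 4 * eps * n%:R.
  have NA : (#|N| <= \sum_(a in A) #|[set u | adj G a u]|)%N.
    apply: (@leq_trans #|\bigcup_(a in A) [set u | adj G a u]|).
      apply/subset_leq_card/fintype.subsetP => u; rewrite inE => /exists_inP[a aA au].
      by apply/finset.bigcupP; exists a; rewrite ?inE.
    elim/big_rec2: _ => [|a k B _ IH]; first by rewrite cards0.
    by rewrite cardsU (leq_trans (leq_subr _ _)) // leq_add2l.
  apply: (@le_trans _ _ (\sum_(a in A) (4 * q * n%:R))).
    apply: (@le_trans _ _ (\sum_(a in A) #|[set u | adj G a u]|)%:R).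
      by rewrite ler_nat.
    by rewrite natr_sum; apply: ler_sum => a _; have := Hhigh a; rewrite /large_degree -leNgt.
  rewrite sumr_const AL -mulr_natr.
  have : 0 <= n%:R :> R by []. nra.
(* Otherwise take [x] vertices of [X]. Each has more than [g1 * q * n] neighbours in [N], of which
   at most [x], hence at most half of that bound, lie in the chosen set; the remaining edges form a
   dense pair. *)
have X_lt : (#|X| < x)%N.
  rewrite ltnNge; apply/negP => xX.
  have [X' X'X X'x] : exists2 X' : {set 'I_n}, X' \subset X & #|X'| = x.
    have : (0 < #|[set B : {set 'I_n} | B \subset X & #|B| == x]|)%N.
      by rewrite cards_draws bin_gt0.
    by rewrite card_gt0 => /set0Pn[B]; rewrite inE => /andP[? /eqP ?]; exists B.
  have dj : [disjoint X' & N :\: X'] by rewrite disjoint_sym finset.disjoints_subset finset.setDE finset.subsetIr.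
  have Yle : #|N :\: X'|%:R <= 4 * eps * n%:R.
    by apply: le_trans N_le; rewrite ler_nat subset_leq_card // finset.subsetDl.
  have /negP := Hdense _ _ dj X'x Yle; apply; rewrite /dense_pair double_count_adj natr_sum.
  have -> : g1 / 2 * q * n%:R * x%:R = \sum_(v in X') (g1 / 2 * q * n%:R).
    by rewrite sumr_const X'x mulr_natr.
  apply: ler_sum => v /(fintype.subsetP X'X); rewrite inE => /andP[_ vN].
  have : (#|[set u in N | adj G v u]| <= #|[set y in N :\: X' | adj G v y]| + x)%N.
    rewrite -X'x; apply: leq_trans (_ : _ <= #|[set y in N :\: X' | adj G v y] :|: X'|)%N _.
      apply/subset_leq_card/fintype.subsetP => u; rewrite !inE => /andP[-> ->].
      by case: (u \in X').
    by rewrite cardsU leq_subr.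
  rewrite -(ler_nat R) natrD; lra.
exists (sparse_graph (residue m.+2) G A X E); split.
- exact: sparse_spanning.
- apply: leq_trans ts _; apply: (@sparse_chi _ _ _ _ A _ E s (2 * (4 * g))) => //; first by rewrite !muln_gt0.
  by rewrite AL; lia.
- apply: le_min_degree; first by rewrite card_ord.
  move=> v; pose d := Num.truncn (g1 * q * n%:R).
  have gq : 0 <= g1 * q * n%:R by rewrite !mulr_ge0.
  have dle : d%:R <= g1 * q * n%:R by rewrite truncn_le.
  have [i|i Hi] := @sparse_degree _ m (residue m.+2) G A X E d v.
    move=> iA iX; rewrite -ltnS -(ltr_nat R); apply: le_lt_trans (truncnS_gt _).
    by move: iX; rewrite !inE iA /= -leNgt.
  have := Hlow v i; rewrite /small_degree -leNgt => hi.
  have := degN _ (card_nonresidue R v i) => hN.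
  apply: le_trans hN _; rewrite lerBlDr lerBlDr lerBlDr.
  apply: le_trans hi _.
  have -> : [set y in [set u : 'I_n | residue m.+2 u != i] | adj G v y] =
      [set u | adj G v u & residue m.+2 u != i].
    by apply/setP => u; rewrite !inE andbC.
  move: Hi; rewrite -(ler_nat R) !natrD AL => Hi; apply: le_trans Hi _.
  have : #|X|%:R <= x%:R :> R by rewrite ler_nat ltnW.
  lra.
- apply: sparse_colourable => T Tt; apply: Eb; exact: leq_trans Tt ts.
Qed.

End Existence.

(** * Asymptotics *)

Section Large.
Variable R : realType.
Implicit Types (P Q : nat -> R -> Prop) (a : R).

(* The regime 1 << n, n^(-1/2) << q << 1. *)
Definition large P := exists M : R, forall n q, 0 < q -> q <= 1 ->
  M <= n%:R -> M <= q * Num.sqrt n%:R -> q * M <= 1 -> P n q.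

Lemma large_and P Q : large P -> large Q -> large (fun n q => P n q /\ Q n q).
Proof.
move=> [M1 HP] [M2 HQ]; exists (Num.max M1 M2) => n q q0 q1.
rewrite !ge_max => /andP[n1 n2] /andP[s1 s2] qM; split.
  by apply: HP => //; apply: le_trans qM; rewrite ler_pM2l // le_max lexx.
by apply: HQ => //; apply: le_trans qM; rewrite ler_pM2l // le_max lexx orbT.
Qed.

Lemma large_imp P Q :
  (forall n q, 0 < q -> q <= 1 -> P n q -> Q n q) -> large P -> large Q.
Proof. by move=> PQ [M HM]; exists M => n q q0 q1 *; apply: PQ => //; apply: HM. Qed.

Lemma large_n a : large (fun n q => a <= n%:R).
Proof. by exists a. Qed.

Lemma large_q_sqrt a : large (fun n q => a <= q * Num.sqrt n%:R).
Proof. by exists a. Qed.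

Lemma large_q a : large (fun n q => q * a <= 1).
Proof. by exists a. Qed.

Lemma large_sqrt a : large (fun n q => a <= Num.sqrt n%:R).
Proof.
apply: large_imp (large_q_sqrt a) => n q q0 q1 h; apply: le_trans h _.
by rewrite ler_piMl // sqrtr_ge0.
Qed.

Lemma large_qqn a : large (fun n q => a <= q * q * n%:R).
Proof.
apply: large_imp (large_and (large_q_sqrt a) (large_q_sqrt 1)) => n q q0 q1 [ha h1].
have e : (n%:R : R) = Num.sqrt n%:R * Num.sqrt n%:R by rewrite -expr2 sqr_sqrtr.
rewrite [X in _ * X]e mulrACA; nra.
Qed.

Lemma large_qn a : large (fun n q => a <= q * n%:R).
Proof.
apply: large_imp (large_and (large_qqn a) (large_qqn 0)) => n q q0 q1 [ha h0].
have : 0 <= (n%:R : R) by []. nra.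
Qed.

Lemma expRN_le_inv (x : R) : 0 < x -> expR (- x) <= x^-1.
Proof.
move=> x0; rewrite expRN lef_pV2 ?posrE ?expR_gt0 //.
by have := expR_ge1Dx x; lra.
Qed.

Lemma expRN_le_cube (x : R) : 0 < x -> expR (- x) <= 27 / x ^+ 3.
Proof.
move=> x0; rewrite -[27 / _]invrK invf_div expRN lef_pV2 ?posrE ?expR_gt0 ?divr_gt0 ?exprn_gt0 //.
rewrite {2}(_ : x = (x / 3) * 3%:R); last by field.
rewrite expRM_natr (_ : x ^+ 3 / 27 = (x / 3) ^+ 3); last by field.
rewrite lerXn2r ?nnegrE ?expR_ge0 ?divr_ge0 ?ltW //.
by apply: lt_le_trans (expR_ge1Dx _); lra.
Qed.

(** With [y] the square root of [n], the exponent is at least [c * y] because [q * y >= 1]. The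
    cubic bound on the exponential then beats [n = y ^+ 2]. *)
Lemma large_expRN a c eta : 0 <= a -> 0 < c -> 0 < eta ->
  large (fun n q => n%:R * a * expR (- (c * (q * n%:R))) <= eta).
Proof.
move=> a0 c0 e0.
have F1 := large_q_sqrt 1; have F2 := large_sqrt (27 * a / (c ^+ 3 * eta)).
have F3 := large_sqrt 1.
apply: large_imp (large_and F1 (large_and F2 F3)) => n q q0 q1 [h1 [h2 h3]].
set y := Num.sqrt n%:R in h1 h2 h3.
have e : (n%:R : R) = y ^+ 2 by rewrite sqr_sqrtr.
have y0 : 0 < y by lra.
have cy : 0 < c * y by rewrite mulr_gt0.
have le : expR (- (c * (q * n%:R))) <= 27 / (c * y) ^+ 3.
  apply: le_trans (expRN_le_cube cy); rewrite ler_expR lerN2 ler_pM2l // e.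
  by rewrite expr2 mulrA ler_peMl // ltW.
apply: le_trans (ler_wpM2l _ le) _; first by rewrite mulr_ge0.
have -> : n%:R * a * (27 / (c * y) ^+ 3) = 27 * a / (c ^+ 3 * y).
  by rewrite e; field; rewrite (gt_eqF y0) (gt_eqF c0).
rewrite ler_pdivrMr ?mulr_gt0 ?exprn_gt0 //.
move: h2; rewrite ler_pdivrMr ?mulr_gt0 ?exprn_gt0 //; lra.
Qed.

End Large.

(** * Union bounds over vertices and over pairs of sets *)

Section BadEvents.
Variable R : realType.
Implicit Types (eta : R).

Lemma large_small_degree m (d eta : R) : 0 < d -> 0 < eta ->
  large (fun n (q : R) => prob q (fun G : sgraph 'I_n =>
    [exists vi : 'I_n * 'I_m.+3 in predT, small_degree q G d vi.1 vi.2]) <= eta).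
Proof.
move=> d0 e0.
have c0 : 0 < d ^+ 2 / 16 by rewrite divr_gt0 ?exprn_gt0.
have F := large_expRN (ler0n R m.+3) c0 e0.
apply: large_imp (large_and F (large_n 8)) => n q q0 q1 [h n8].
have q01 : 0 <= q <= 1 by rewrite ltW.
apply: le_trans h.
apply: (@le_trans _ _ (#|predT : pred ('I_n * 'I_m.+3)|%:R * expR (- (d ^+ 2 / 16 * (q * n%:R))))).
  apply: prob_exists_le => // -[v i] _ /=.
  apply: le_trans (prob_degree_low q01 v _ (ltW d0)) _.
  rewrite ler_expR !mulNr lerN2.
  have := card_nonresidue R v i; move: #|_ :\ _| => N hN.
  have : 2^-1 <= m.+2%:R / m.+3%:R :> R.
    by rewrite ler_pdivlMr // -(natr1 m.+2) -(natr1 m.+1); have : 0 <= m.+1%:R :> R by []; lra.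
  move=> /(ler_wpM2l (ler0n R n)) h2.
  have N4 : n%:R / 4 <= N%:R :> R.
    by apply: le_trans hN; move: (n%:R * (_ / _)) h2 => a h2; lra.
  rewrite (_ : d ^+ 2 / 16 * (q * n%:R) = d ^+ 2 / 4 * q * (n%:R / 4)); last by field.
  by rewrite ler_wpM2l // mulr_ge0 ?divr_ge0 ?exprn_ge0 // ltW.
by rewrite card_prod !card_ord natrM.
Qed.

Lemma large_large_degree eta : 0 < eta ->
  large (fun n (q : R) => prob q (fun G : sgraph 'I_n =>
    [exists v : 'I_n in predT, large_degree q G v]) <= eta).
Proof.
move=> e0; have F := large_expRN (ler01 : 0 <= 1 :> R) ltr01 e0.
apply: large_imp F => n q q0 q1 h.
have q01 : 0 <= q <= 1 by rewrite ltW.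
apply: le_trans h; rewrite mulr1 mul1r -[X in X%:R * _](card_ord n).
by apply: prob_exists_le => // v _; exact: prob_degree_high.
Qed.

(** Just above [12 / (g1 * q)], so of order [1 / q]: large enough for the exponent [3 * n] in the
    union bound over all pairs of sets. *)
Definition pair_size (g1 q : R) : nat := (Num.truncn (12 / (g1 * q))).+1.

(** The size bounds leave [- g1 * q * x * n / 4] in the exponent, at most [- 3 * n], while there are
    at most [4 ^ n <= expR (2 * n)] pairs of sets. *)
Lemma large_dense_pair (g1 eta : R) : 0 < g1 -> 0 < eta ->
  large (fun n (q : R) => prob q (fun G : sgraph 'I_n =>
    [exists XY : {set 'I_n} * {set 'I_n} in
       [pred XY : {set 'I_n} * {set 'I_n} | [&& [disjoint XY.1 & XY.2], #|XY.1| == pair_size g1 q &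
          #|XY.2|%:R <= 4 * (g1 / 48) * n%:R]],
      dense_pair G XY.1 XY.2 (g1 / 2 * q * n%:R * (pair_size g1 q)%:R)]) <= eta).
Proof.
move=> g0 e0.
apply: large_imp (large_and (large_n eta^-1) (large_n 1)) => n q q0 q1 [h1 h2].
have q01 : 0 <= q <= 1 by rewrite ltW.
set x := pair_size g1 q.
have qx : 12 <= g1 * q * x%:R.
  have := truncnS_gt (12 / (g1 * q)); rewrite ltr_pdivrMr ?mulr_gt0 // mulrC.
  exact: ltW.
apply: le_trans (prob_exists_le q01 (c := expR (- (3 * n%:R))) _) _.
  move=> [X Y]; rewrite inE /= => /and3P[dj /eqP Xx Yle].
  apply: le_trans (prob_edges_between q01 _ dj) _.
  rewrite ler_expR Xx natrM.
  have : q * x%:R * #|Y|%:R <= q * x%:R * (4 * (g1 / 48) * n%:R).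
    by rewrite ler_wpM2l // mulr_ge0 // ltW.
  have : 12 * n%:R <= g1 * q * x%:R * n%:R by rewrite ler_wpM2r.
  move: (n%:R) (x%:R) (#|Y|%:R) => a b c; lra.
have cT : #|[pred XY : {set 'I_n} * {set 'I_n} | [&& [disjoint XY.1 & XY.2], #|XY.1| == x &
          #|XY.2|%:R <= 4 * (g1 / 48) * n%:R]]|%:R <= expR (2 * n%:R) :> R.
  apply: (@le_trans _ _ ((2 ^ n * 2 ^ n)%N%:R)).
    rewrite ler_nat; apply: leq_trans (max_card _) _.
    by rewrite card_prod -!cardsT -!finset.powersetT !card_powerset !cardsT !card_ord.
  rewrite -expnD addnn -mul2n natrX -natrM -[X in expR X]mul1r expRM_natr.
  by rewrite lerXn2r ?nnegrE ?expR_ge0 //; have := expR_ge1Dx (1 : R); lra.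
apply: le_trans (ler_wpM2r (expR_ge0 _) cT) _; rewrite -expRD.
rewrite (_ : _ + _ = - n%:R); last by ring.
apply: le_trans (expRN_le_inv _) _; first by lra.
by rewrite -[eta]invrK lef_pV2 ?posrE ?invr_gt0 //; lra.
Qed.

End BadEvents.

(** Bernoulli's inequality [1 + k / a <= (1 + 1 / a) ^ k] with denominators cleared. *)
Lemma bernoulli_nat a k : (a ^ k * (a + k) <= a * a.+1 ^ k)%N.
Proof.
elim: k => [|k IH]; first by rewrite !expn0 mul1n muln1 addn0.
rewrite !expnS; nia.
Qed.

(** * Union bound over the states of the greedy construction *)

Section BadConfig.
Variable R : realType.

Lemma bernoulli_sub (q : R) k : 0 <= q <= 1 -> 1 - k%:R * q <= (1 - q) ^+ k.
Proof.
move=> /andP[q0 q1]; elim: k => [|k IH]; first by rewrite expr0 mul0r subr0.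
rewrite exprS -natr1; have := ler0n R k => k0.
have : (1 - q) * (1 - k%:R * q) <= (1 - q) * (1 - q) ^+ k by rewrite ler_wpM2l // subr_ge0.
by have := mulr_ge0 k0 (mulr_ge0 q0 q0); nra.
Qed.

(** Here [mu] is bounded below by a constant: [(1 - q) ^+ (#|A| - K)] is at least one half because
    [#|A| * q <= eps], and [q * (2 * g)] is at least [eps / (8 * s)], which controls [q ^+ K] times
    the number of good sets. The failure probability is thus exponentially small in [n]. *)
Lemma prob_bad_config n (q eps : R) s K D g lam A I E :
  0 <= q <= 1 -> (0 < s)%N -> (0 < K)%N -> D = (16 * K * s)%N ->
  (K * D.+1 ^ s <= g)%N -> (0 < lam)%N ->
  (24 * lam * (4 * s).-1 ^ K <= (4 * s) ^ K)%N ->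
  0 < eps <= 2^-1 ->
  (8 * s * g)%:R * q <= eps -> eps <= (16 * s)%:R * g%:R * q ->
  (8 * s * g)%:R <= n%:R / 2 :> R ->
  @config n s K D g A I E ->
  prob q (fun G : sgraph 'I_n => bad_config s G K D lam A I E) <=
  2 * expR (- ((eps / (8 * s)%:R) ^+ K / (32 * K`! * lam)%:R * n%:R)).
Proof.
move=> q01 s0 K0 DE Kg lam0 Klam /andP[e0 e1] Lq gq Ln.
move=> /and5P[/andP[hA AL] EK /forallP degD IA hI].
have /andP[q0 q1] := q01.
have KKP B : B \in good_sets E s D K A -> (B \subset A) /\ #|B| = K.
  rewrite inE => /and3P[BM /eqP BK _]; split => //.
  by apply: fintype.subset_trans BM _; apply/fintype.subsetP => u; rewrite inE => /andP[].
have KIK : [set B in good_sets E s D K A | [disjoint B & I]] \subset good_sets E s D K A.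
  by apply/fintype.subsetP => B; rewrite inE => /andP[].
have hit := card_good_sets_missing s0 K0 DE Kg AL EK degD IA hI.
have good := card_good_sets s0 K0 DE Kg AL EK degD.
have lamKI : (24 * lam * #|[set B in good_sets E s D K A | [disjoint B & I]]|
    <= #|good_sets E s D K A|)%N.
  case: (posnP ((4 * s).-1 ^ K)) => [z|pos].
    by rewrite z mul0n leqn0 muln_eq0 expn_eq0 muln_eq0 /= eqn0Ngt s0 /= in hit;
       rewrite (eqP hit) muln0.
  rewrite -(leq_pmul2l pos); apply: leq_trans hit.
  by rewrite mulnA leq_mul // mulnC.
set mu : R := #|good_sets E s D K A|%:R * (q ^+ K * (1 - q) ^+ (#|A| - K)).
apply: le_trans (prob_hits q01 KKP KIK lam0 lamKI (erefl mu)) _.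
rewrite ler_wpM2l // ler_expR lerN2.
have mu_ge : (eps / (8 * s)%:R) ^+ K / (2 * K`!)%:R <= mu.
  have f0 : 0 < K`!%:R :> R by rewrite ltr0n fact_gt0.
  have w_ge : 2^-1 <= (1 - q) ^+ (#|A| - K).
    apply: le_trans (bernoulli_sub _ q01).
    have : (#|A| - K)%:R * q <= (8 * s * g)%:R * q.
      by rewrite ler_wpM2r // ler_nat (leq_trans (leq_subr _ _)).
    lra.
  have good2 : ((2 * g)%:R) ^+ K <= K`!%:R * #|good_sets E s D K A|%:R :> R.
    rewrite -natrX -natrM ler_nat; apply: leq_trans good; apply: leq_expl.
    by move: (#|A|) hA => b; clear; lia.
  have : (eps / (8 * s)%:R) ^+ K <= (q * (2 * g)%:R) ^+ K.
    apply: lerXn2r; rewrite ?nnegrE ?mulr_ge0 ?divr_ge0 ?(ltW e0) //.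
    rewrite ler_pdivrMr ?ltr0n ?muln_gt0 //.
    by apply: le_trans gq _; rewrite !natrM; lra.
  move=> h; rewrite (natrM _ 2) ler_pdivrMr ?mulr_gt0 //.
  apply: le_trans h _; rewrite exprMn /mu.
  apply: le_trans (ler_wpM2l (exprn_ge0 K q0) good2) _.
  set c := #|_|%:R; set z := q ^+ K; set f := K`!%:R; set w := (1 - q) ^+ _ in w_ge *.
  rewrite (_ : c * (z * w) * (2 * f) = z * (f * c) * (2 * w)); last by ring.
  by rewrite ler_peMr ?mulr_ge0 ?exprn_ge0 //; lra.
have N_ge : n%:R / 2 <= #|~: A|%:R :> R.
  have : (n <= #|~: A| + 8 * s * g)%N.
    by rewrite -[leqLHS]card_ord -(cardsC A) addnC leq_add2l.
  rewrite -(ler_nat R) natrD; lra.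
have mu00 : 0 <= (eps / (8 * s)%:R) ^+ K / (2 * K`!)%:R.
  by rewrite divr_ge0 // exprn_ge0 // divr_ge0 // ltW.
have l0 : 0 < lam%:R :> R by rewrite ltr0n.
have -> : (eps / (8 * s)%:R) ^+ K / (32 * K`! * lam)%:R * n%:R =
    ((eps / (8 * s)%:R) ^+ K / (2 * K`!)%:R) * (n%:R / 2) / (8 * lam%:R).
  have f0 : K`!%:R != 0 :> R by rewrite pnatr_eq0 -lt0n fact_gt0.
  rewrite !natrM; move: (_ ^+ K) => b; field.
  by rewrite f0 gt_eqF.
rewrite ler_wpM2r ?invr_ge0 ?mulr_ge0 // ler_pM // divr_ge0 //.
Qed.

(** Chosen so that the final size [8 * s * g] of [A] is about [eps / q]. *)
Definition scale (eps : R) s (q : R) : nat := Num.truncn (eps / ((8 * s)%:R * q)).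

Lemma large_scale (eps : R) s k : (0 < s)%N -> 0 < eps <= 2^-1 ->
  large (fun n (q : R) => [/\ (k <= scale eps s q)%N,
    (8 * s * scale eps s q)%:R * q <= eps,
    eps <= (16 * s)%:R * (scale eps s q)%:R * q &
    (8 * s * scale eps s q)%:R <= n%:R / 2 :> R]).
Proof.
move=> s0 /andP[e0 e1].
have s0' : 0 < (8 * s)%:R :> R by rewrite ltr0n muln_gt0.
apply: large_imp (large_and (large_q (k%:R * (8 * s)%:R / eps))
  (large_and (large_q ((16 * s)%:R / eps)) (large_qn 1))) => n q q0 q1 [h1 [h2 h3]].
have sq0 : 0 < (8 * s)%:R * q by rewrite mulr_gt0.
have y0 : 0 <= eps / ((8 * s)%:R * q) by rewrite divr_ge0 // ltW.
have g1 : (8 * s * scale eps s q)%:R * q <= eps.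
  have : (scale eps s q)%:R <= eps / ((8 * s)%:R * q) by rewrite truncn_le.
  by rewrite ler_pdivlMr // natrM; lra.
split => //.
- rewrite truncn_ge_nat // ler_pdivlMr //.
  by move: h1; rewrite mulrA ler_pdivrMr // mul1r; lra.
- have := truncnS_gt (eps / ((8 * s)%:R * q)); rewrite -/(scale eps s q) ltr_pdivrMr //.
  rewrite -natr1 => h4; move: h2; rewrite mulrA ler_pdivrMr // mul1r.
  move: h4; rewrite !natrM; lra.
- rewrite -(ler_pM2r q0); apply: le_trans g1 _; lra.
Qed.

(** A state consists of [O(1 / q)] vertices and edges, and [1 / q] is at most the square root of
    [n]; so the number of states is [expR] of [o(n)] and the exponential bound for one state
    survives the union. *)
Lemma large_bad_config (eps eta : R) s K D lam :
  (0 < s)%N -> (0 < K)%N -> D = (16 * K * s)%N -> (0 < lam)%N ->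
  (24 * lam * (4 * s).-1 ^ K <= (4 * s) ^ K)%N ->
  0 < eps <= 2^-1 -> 0 < eta ->
  large (fun n (q : R) => prob q (fun G : sgraph 'I_n =>
    [exists t : {set 'I_n} * {set 'I_n} * {set 'I_n * 'I_n} in
       [pred t : {set 'I_n} * {set 'I_n} * {set 'I_n * 'I_n} |
          config s K D (scale eps s q) t.1.1 t.1.2 t.2],
       bad_config s G K D lam t.1.1 t.1.2 t.2]) <= eta).
Proof.
move=> s0 K0 DE lam0 Klam e01 eta0.
pose c : R := (eps / (8 * s)%:R) ^+ K / (32 * K`! * lam)%:R.
have c0 : 0 < c.
  have /andP[e0 _] := e01.
  by rewrite divr_gt0 ?exprn_gt0 ?divr_gt0 ?ltr0n ?muln_gt0 ?fact_gt0 ?s0.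
pose a : R := 32 * K.+1%:R / c.
apply: large_imp (large_and (large_scale (K * D.+1 ^ s) s0 e01) (large_and
  (large_q_sqrt 1) (large_and (large_n (a ^+ 4)) (large_and (large_n (4 / (c * eta)))
  (large_n 1))))) => n q q0 q1 [[g1 g2 g3 g4] [h1 [h2 [h3 h4]]]].
set g := scale eps s q in g1 g2 g3 g4 *.
have q01 : 0 <= q <= 1 by rewrite ltW.
apply: le_trans (prob_exists_le q01 (c := 2 * expR (- (c * n%:R))) _) _.
  by move=> [[A I] E]; rewrite inE /= => cf; exact: (prob_bad_config q01 s0 K0 DE g1 lam0 Klam e01 g2 g3 g4 cf).
(* As [n.+1 = w ^+ 4 <= expR w ^+ 4] and [L <= w ^+ 2], the [n.+1 ^ (2 * K.+1 * L)] states number at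
   most [expR (8 * K.+1 * w ^+ 3)], which is below [expR (c * n / 2)] once [w >= a]. *)
pose L := (8 * s * g)%N; pose w : R := Num.sqrt (Num.sqrt n.+1%:R).
have w0 : 0 <= w by exact: sqrtr_ge0.
have w4 : n.+1%:R = w ^+ 4 by rewrite (exprM w 2 2) !sqr_sqrtr ?sqrtr_ge0.
have card_cf : (#|[pred t : {set 'I_n} * {set 'I_n} * {set 'I_n * 'I_n} |
          config s K D g t.1.1 t.1.2 t.2]| <= n.+1 ^ (2 * K.+1 * L))%N.
  apply: (@leq_trans #|finset.setX (finset.setX [set S : {set 'I_n} | #|S| <= L]
      [set S : {set 'I_n} | #|S| <= L]) [set S : {set 'I_n * 'I_n} | #|S| <= K * L]|)%N.
    apply/subset_leq_card/fintype.subsetP => -[[A I] E].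
    rewrite !inE /= => /and5P[/andP[_ AL] EK _ IA _]; rewrite AL /=.
    rewrite (leq_trans (subset_leq_card IA) AL) /=.
    by apply: leq_trans EK _; rewrite leq_mul.
  rewrite !cardsX; apply: (@leq_trans (n.+1 ^ L * n.+1 ^ L * (n.+1 ^ 2) ^ (K * L)))%N.
    have := card_small_sets 'I_n L; rewrite card_ord => cL.
    have := card_small_sets ('I_n * 'I_n)%type (K * L); rewrite card_prod card_ord => cE.
    rewrite !leq_mul //; apply: leq_trans cE _; apply: leq_expl.
    by rewrite -mulnn mulSn mulnS addSn ltnS addnA leq_addl.
  by rewrite -expnM -!expnD addnn -mul2n -mulnDr -mulSn mulnA.
have cf_le : #|[pred t : {set 'I_n} * {set 'I_n} * {set 'I_n * 'I_n} |
    config s K D g t.1.1 t.1.2 t.2]|%:R <= expR (c * n%:R / 2) :> R.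
  apply: (@le_trans _ _ ((n.+1 ^ (2 * K.+1 * L))%N%:R)); first by rewrite ler_nat.
  rewrite natrX w4 -exprM; apply: (@le_trans _ _ (expR w ^+ (4 * (2 * K.+1 * L)))).
    apply: lerXn2r; rewrite ?nnegrE ?expR_ge0 //.
    by apply: le_trans (expR_ge1Dx w); lra.
  rewrite -expRM_natr ler_expR.
  have Ln : L%:R <= Num.sqrt n%:R :> R.
    rewrite -(ler_pM2l q0); apply: le_trans h1; rewrite mulrC; apply: le_trans g2 _.
    by case/andP: e01 => _ ?; lra.
  have Lw : L%:R <= w ^+ 2.
    by apply: le_trans Ln _; rewrite sqr_sqrtr ?sqrtr_ge0 // ler_wsqrtr // ler_nat.
  have aw : a <= w.
    have a0 : 0 <= a by apply: divr_ge0; [rewrite mulr_ge0|exact: ltW].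
    rewrite -(@ler_pXn2r _ 4) ?nnegrE // -w4; apply: le_trans h2 _.
    by rewrite ler_nat.
  have {aw} : 32 * K.+1%:R <= w * c by move: aw; rewrite /a ler_pdivrMr.
  move=> /(ler_wpM2r (exprn_ge0 3 w0)) aw.
  have Lw3 : 8 * K.+1%:R * w * L%:R <= 8 * K.+1%:R * w * w ^+ 2.
    by rewrite ler_wpM2l // !mulr_ge0.
  have w4n : w ^+ 4 <= 2 * n%:R by rewrite -w4 -natr1; lra.
  have cw : w ^+ 4 * c <= 2 * n%:R * c by rewrite ler_wpM2r // ltW.
  have -> : w * (4 * (2 * K.+1 * L))%:R = 8 * K.+1%:R * w * L%:R.
    by rewrite (natrM _ 4) (natrM _ (2 * K.+1)) (natrM _ 2); ring.
  apply: le_trans Lw3 _.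
  have -> : 8 * K.+1%:R * w * w ^+ 2 = 32 * K.+1%:R * w ^+ 3 / 4 by field.
  have cw' : w * c * w ^+ 3 <= 2 * n%:R * c by rewrite (_ : _ * _ = w ^+ 4 * c) //; ring.
  have := le_trans aw cw'; lra.
apply: le_trans (ler_wpM2r _ cf_le) _; first by rewrite mulr_ge0 ?expR_ge0.
rewrite mulrCA -expRD (_ : _ + _ = - (c * n%:R / 2)); last by field.
have cn0 : 0 < c * n%:R by rewrite mulr_gt0 //; lra.
apply: le_trans (ler_wpM2l _ (expRN_le_inv _)) _ => //; first by rewrite divr_gt0.
rewrite invf_div (_ : 2 * (2 / (c * n%:R)) = 4 / (c * n%:R)); last by ring.
rewrite ler_pdivrMr // (_ : eta * (c * n%:R) = n%:R * (c * eta)); last by ring.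
by move: h3; rewrite ler_pdivrMr // mulr_gt0.
Qed.

End BadConfig.

Lemma chi_le (V : finType) (G : sgraph V) k : colourable G k -> (chi G <= k)%N.
Proof. by rewrite /chi; case: ex_minnP => m _; apply. Qed.

(** A copy of [H] has at most [s] vertices; padded to exactly [s], its vertex set carries the graph
    formed by the edges of the copy alone, and a [k]-colouring of that graph pulls back to [H]. *)
Lemma free_of_all_subgraphs_colourable (V W : finType) (H : sgraph W) (G : sgraph V) s k :
  (#|W| <= s)%N -> (s <= #|V|)%N -> (k < chi H)%N ->
  all_subgraphs_colourable G s k -> Defs.free H G.
Proof.
move=> Ws sV kH Gk [f [f_inj fH]].
have [S fS Ss] : exists2 S : {set V}, [set f w | w : W] \subset S & #|S| = s.
  have cf : #|[set f w | w : W]| = #|W| by rewrite card_imset.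
  have [T TC Ts] : exists2 T : {set V}, T \subset ~: [set f w | w : W] & #|T| = (s - #|W|)%N.
    have : (0 < #|[set T : {set V} | T \subset ~: [set f w | w : W] & #|T| == (s - #|W|)%N]|)%N.
      by rewrite cards_draws bin_gt0 cardsCs finset.setCK cf leq_sub2r.
    by rewrite card_gt0 => /set0Pn[T]; rewrite inE => /andP[? /eqP ?]; exists T.
  exists ([set f w | w : W] :|: T); first exact: finset.subsetUl.
  rewrite cardsU cf Ts (_ : _ :&: T = finset.set0) ?cards0 ?subn0 ?subnKC //.
  by apply/eqP; rewrite finset.setI_eq0 disjoint_sym finset.disjoints_subset.
have fwS w : f w \in S by rewrite (fintype.subsetP fS) // imset_f.
pose r : rel {x : V | x \in S} := fun x y =>
  [exists u, exists v, [&& adj H u v, val x == f u & val y == f v]].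
pose es : {set {set {x : V | x \in S}}} :=
  [set e : {set {x : V | x \in S}} | (#|e| == 2%N) && [exists x, exists y, (e == [set x; y]) && r x y]].
have esP : [forall e in es, #|e| == 2%N] by apply/forall_inP => e; rewrite inE => /andP[].
have rG x y : r x y -> adj G (val x) (val y).
  by move=> /existsP[u /existsP[v /and3P[uv /eqP -> /eqP ->]]]; exact: fH.
have adjF x y : adj (SGraph esP) x y -> adj G (val x) (val y).
  rewrite {1}/adj inE => /andP[_ /existsP[x' /existsP[y' /andP[/eqP e /rG]]]].
  have := congr1 (fun B : {set {x : V | x \in S}} => val @: B) e.
  by rewrite !imsetU !imset_set1 /adj => ->.
have /existsP[c /forallP cP] := Gk S _ Ss adjF.
suff : colourable H k by move=> /chi_le; rewrite leqNgt kH.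
apply/existsP; exists [ffun w => c (Sub (f w) (fwS w))].
apply/forallP => u; apply/forallP => v; apply/implyP => uv; rewrite !ffunE.
move/forallP: (cP (Sub (f u) (fwS u))) => /(_ (Sub (f v) (fwS v)))/implyP; apply.
rewrite /adj inE cards2 -val_eqE /= (inj_eq f_inj).
have -> : u != v.
  by apply: contraTneq uv => ->; rewrite adj_irrefl.
apply/existsP; exists (Sub (f u) (fwS u)); apply/existsP; exists (Sub (f v) (fwS v)).
rewrite eqxx /=; apply/existsP; exists u; apply/existsP; exists v.
by rewrite uv !eqxx.
Qed.

Local Open Scope classical_set_scope.
Local Open Scope ring_scope.

(** * Choice of the constants *)

Section Main.
Variable R : realType.

Definition has_sparse_subgraph n (r s : nat) (gamma q : R) : set (sgraph 'I_n) :=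
  [set Gam : sgraph 'I_n |
       exists G : sgraph 'I_n,
         [/\ spanning_subgraph G Gam,
             (s <= chi G)%N,
             ((r%:R - 2) / (r%:R - 1) - gamma) * q * n%:R
               <= (min_degree G)%:R
           & all_subgraphs_colourable G s r.-1]].

Lemma Gnp_prob_ge0 n (q : R) (A : set (sgraph 'I_n)) : 0 <= q <= 1 -> 0 <= Gnp_prob q A.
Proof. by move=> q01; apply: sumr_ge0 => G _; exact: Gnp_weight_ge0. Qed.

Lemma Gnp_probD_le1 n (q : R) (A B : set (sgraph 'I_n)) : 0 <= q <= 1 ->
  (forall G, A G -> ~ B G) -> Gnp_prob q A + Gnp_prob q B <= 1.
Proof.
move=> q01 AB; rewrite -(expect1 n q) /Gnp_prob /expect.
rewrite [X in X + _]big_mkcond [X in _ + X]big_mkcond -big_split /=.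
apply: ler_sum => G _; have w := Gnp_weight_ge0 q01 G; rewrite mulr1.
case: ifPn; rewrite ?inE => AG; case: ifPn; rewrite ?inE => BG; rewrite ?addr0 ?add0r //.
by case: (AB G).
Qed.

Lemma Gnp_prob_le1 n (q : R) (A : set (sgraph 'I_n)) : 0 <= q <= 1 -> Gnp_prob q A <= 1.
Proof.
move=> q01; have := @Gnp_probD_le1 n q A set0 q01; move/(_ (fun _ _ => id)).
by have := Gnp_prob_ge0 (set0 : set (sgraph 'I_n)) q01; lra.
Qed.

Lemma large_sparse_subgraph (r s : nat) (gamma eta : R) : (4 <= r)%N -> 0 < gamma -> 0 < eta ->
  large (fun n q => 1 - eta <= Gnp_prob q (@has_sparse_subgraph n r s gamma q)).
Proof.
move=> r4 gamma0 eta0.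
have [m ->] : exists m, r = m.+4 by exists (r - 4)%N; rewrite -addn4 subnK.
(* Capping [gamma] only strengthens the degree bound and makes [g1] and [eps] small; [g1] is the
   unit in which degree losses are measured. *)
pose gam := Num.min gamma 1; pose g1 := gam / 8; pose eps := g1 / 48.
have gam0 : 0 < gam by rewrite lt_min gamma0 ltr01.
have gam1 : gam <= 1 by rewrite ge_min lexx orbT.
have gam_le : gam <= gamma by rewrite ge_min lexx.
have g10 : 0 < g1 by rewrite /g1; lra.
have g1_le : g1 <= 8^-1 by rewrite /g1; lra.
have eps01 : 0 < eps <= 2^-1 by rewrite /eps /g1; lra.
(* The construction runs with [s.+1], which is positive. Bernoulli's inequality turns this [K] into
   [(1 - 1 / (4 * s.+1)) ^ K <= 1 / (24 * lam)]. *)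
pose lam := (64 ^ s.+1).+1; pose K := (24 * lam * (4 * s.+1).-1)%N.
pose D := (16 * K * s.+1)%N.
have a0 : (0 < (4 * s.+1).-1)%N by lia.
have K0 : (0 < K)%N by rewrite /K !muln_gt0 a0.
have KD : (K <= D)%N by rewrite /D mulnAC leq_pmull.
have Klam : (24 * lam * (4 * s.+1).-1 ^ K <= (4 * s.+1) ^ K)%N.
  rewrite -(leq_pmul2l a0); apply: leq_trans (bernoulli_nat _ _).
  by rewrite mulnCA mulnA -/K mulnC leq_mul // leq_addl.
have eta40 : 0 < eta / 4 by rewrite divr_gt0.
have F1 := large_small_degree m g10 eta40.
have F2 := large_large_degree eta40.
have F3 := large_dense_pair g10 eta40.
have F4 := large_bad_config (ltn0Sn s) K0 (erefl D) (ltn0Sn _) Klam eps01 eta40.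
have F5 := large_scale (K * D.+1 ^ s.+1).+1 (ltn0Sn s) eps01.
(* Both [x] and the size of [A] are of order [1 / q] and have to be small against [g1 * q * n]; this
   is where [q] must be much larger than [n ^ (-1/2)]. *)
have F6 := large_qqn (26 / g1 ^+ 2 + g1^-1).
have F7 := large_qn (2 / g1).
apply: large_imp (large_and F1 (large_and F2 (large_and F3 (large_and F4
  (large_and F5 (large_and F6 F7)))))).
move=> n q q0 q1 [B1 [B2 [B3 [B4 [[S1 S2 S3 S4] [S6 S7]]]]]].
have q01 : 0 <= q <= 1 by rewrite ltW.
set g := scale eps s.+1 q in B4 S1 S2 S3 S4.
set x := pair_size g1 q in B3.
pose P1 (G : sgraph 'I_n) :=
  [exists vi : 'I_n * 'I_m.+3 in predT, small_degree q G g1 vi.1 vi.2].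
set P2 := (fun G : sgraph 'I_n => _) in B2.
set P3 := (fun G : sgraph 'I_n => _) in B3.
set P4 := (fun G : sgraph 'I_n => _) in B4.
apply: (@le_trans _ _ (1 - prob q (fun G => P1 G || (P2 G || (P3 G || P4 G))))).
  rewrite lerB //; apply: le_trans (prob_or q01 _ _) _.
  have := prob_or q01 P2 (fun G => P3 G || P4 G).
  have := prob_or q01 P3 P4.
  by move: B1; rewrite -/P1; lra.
apply: Gnp_prob_ge => // G; rewrite !negb_or => /and4P[N1 N2 N3 N4].
have xq : x%:R * (g1 * q) <= 13.
  have : (Num.truncn (12 / (g1 * q)))%:R <= 12 / (g1 * q) :> R.
    by rewrite truncn_le // divr_ge0 // mulr_ge0 // ltW.
  rewrite ler_pdivlMr ?mulr_gt0 // /x /pair_size -natr1 mulrDl mul1r.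
  have : g1 * q <= 1 by apply: mulr_ile1 => //; [exact: ltW|exact: ltW|lra].
  lra.
have L1 : (8 * s.+1 * g)%:R * q <= 1 by apply: le_trans S2 _; case/andP: eps01; lra.
have q2 : 0 <= q * n%:R by rewrite mulr_ge0 // ltW.
have x_le : 2 * x%:R <= g1 * q * n%:R.
  rewrite -(ler_pM2r (mulr_gt0 g10 q0)).
  have : (26 / g1 ^+ 2) * g1 ^+ 2 <= q * q * n%:R * g1 ^+ 2.
    rewrite ler_wpM2r ?exprn_ge0 ?(ltW g10) //; apply: le_trans S6.
    by rewrite lerDl invr_ge0 ltW.
  rewrite divfK ?expf_neq0 ?gt_eqF // => h.
  rewrite (_ : g1 * q * n%:R * (g1 * q) = q * q * n%:R * g1 ^+ 2); last by ring.
  by rewrite -mulrA; lra.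
have L_le : (8 * s.+1 * g)%:R <= g1 * q * n%:R.
  rewrite -(ler_pM2r q0); apply: le_trans L1 _.
  rewrite (_ : g1 * q * n%:R * q = g1 * (q * q * n%:R)); last by ring.
  apply: (@le_trans _ _ (g1 * g1^-1)); first by rewrite mulfV ?lt0r_neq0.
  rewrite ler_pM2l //; apply: le_trans S6.
  by rewrite lerDr divr_ge0 // exprn_ge0 // ltW.
have two_le : 2 <= g1 * q * n%:R.
  by move: S7; rewrite ler_pdivrMr // mulrC mulrA.
have rho : 0 <= (m.+2%:R / m.+3%:R : R) <= 1.
  by rewrite divr_ge0 // ler_pdivrMr // mul1r ler_nat leqnSn.
have n_pos : (0 : R) <= n%:R by [].
have [F [FG Fchi Fdeg Fcol]] : exists F : sgraph 'I_n,
    [/\ spanning_subgraph F G, (s <= chi F)%N,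
    (m.+2%:R / m.+3%:R - gam) * q * n%:R <= (min_degree F)%:R
    & all_subgraphs_colourable F s m.+3].
  apply: (@exists_sparse_subgraph R n m s.+1 q gam G K D g lam x g1 g1 eps s) => //.
  - by apply: leq_trans S1.
  - rewrite -(ler_nat R); apply: le_trans (_ : (8 * s.+1 * g)%:R <= _).
      by rewrite ler_nat leq_mul // (@leq_trans 8) // leq_pmulr.
    lra.
  - exact: ltW.
  - exact: ltW.
  (* The losses are at most [g1 * q * n] each for the degree deviation, the rounding of parts, the
     neighbours in [N(A)], the set [X] and the set [A]; the budget is eight times that. *)
  - move=> N hN; case/andP: rho => r0 r1.
    have h1 : (1 - g1) * q * (n%:R * (m.+2%:R / m.+3%:R) - 2) <= (1 - g1) * q * N.
      by rewrite ler_wpM2l // mulr_ge0 ?(ltW q0) // subr_ge0; lra.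
    move: h1 r0 r1; move: (m.+2%:R / m.+3%:R) => z h1 r0 r1.
    have h2 : q * n%:R * g1 * z <= q * n%:R * g1.
      by rewrite ler_piMr // mulr_ge0 // ltW.
    have gamE : gam = 8 * g1 by rewrite /g1; field.
    have g1q : 0 <= g1 * q by rewrite mulr_ge0 // ltW.
    rewrite gamE.
    have -> : (z - 8 * g1) * q * n%:R = q * n%:R * z - 8 * (g1 * q * n%:R) by ring.
    have {}h1 : q * n%:R * z - q * n%:R * g1 * z - 2 * q + 2 * (g1 * q) <= (1 - g1) * q * N.
      by apply: le_trans h1; rewrite le_eqVlt; apply/orP; left; apply/eqP; ring.
    have {}h2 : q * n%:R * g1 * z <= g1 * q * n%:R by apply: le_trans h2 _; rewrite le_eqVlt; apply/orP; left; apply/eqP; ring.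
    move: h1 h2 g1q x_le L_le two_le q1; move: (_ * N) (q * n%:R * z) (q * n%:R * g1 * z).
    move: (g1 * q * n%:R) (g1 * q) (x%:R) ((8 * s.+1 * g)%:R); clear => a b c d e f h.
    lra.
  - case/andP: rho => r0 r1; rewrite ler_piMl //.
    apply: (@le_trans _ _ (1 * q)); last by rewrite mul1r.
    by rewrite ler_wpM2r ?(ltW q0) // lerBlDr (le_trans r1) // lerDl ltW.
  - move=> v i; apply: contra N1 => h; apply/exists_inP; exists (v, i) => //.
  - move=> v; apply: contra N2 => h; apply/exists_inP; by exists v.
  - move=> X Y dXY Xx Yle; apply: contra N3 => h; apply/exists_inP; exists (X, Y) => //.
    by rewrite inE /= dXY Xx eqxx Yle.
  - move=> A I E cf; apply: contra N4 => h; apply/exists_inP; exists (A, I, E) => //.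
exists F; split => //; apply: le_trans Fdeg.
rewrite -!mulrA ler_wpM2r //.
have -> : m.+4%:R - 2 = m.+2%:R :> R by rewrite -[m.+4]addn2 natrD addrK.
have -> : m.+4%:R - 1 = m.+3%:R :> R by rewrite -[m.+4%:R]natr1 addrK.
by rewrite lerB.
Qed.

End Main.

(** * Passage to the limit and the bound on the threshold *)

Section Whp.
Variable R : realType.

Lemma whp_large (p : nat -> R) (A : forall n, R -> set (sgraph 'I_n)) :
  (forall n, 0 <= p n <= 1) ->
  much_less (fun n => (Num.sqrt (n%:R : R))^-1) p -> much_less p (fun=> 1) ->
  (forall eta, 0 < eta -> large (fun n q => 1 - eta <= Gnp_prob q (A n q))) ->
  whp p (fun n => A n (p n)).
Proof.
move=> p01 [p_neq0 p_lower] [_ p_upper] HA; apply/cvgrPdist_le => eta eta0.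
have [M HM] := HA eta eta0; pose M' := Num.max M 1.
have M'0 : 0 < M' by rewrite lt_max ltr01 orbT.
have iM'0 : 0 < M'^-1 by rewrite invr_gt0.
have near1 := @cvgr_dist_lt _ _ _ _ _ _ _ p_lower _ iM'0.
have near2 := @cvgr_dist_lt _ _ _ _ _ _ _ p_upper _ iM'0.
near=> n.
have pn0 : p n != 0 by near: n.
have /andP[p0 p1] := p01 n.
have {}p0 : 0 < p n by rewrite lt_neqAle eq_sym pn0.
have n1 : 1 <= (n%:R : R) by near: n; exact: nbhs_infty_ger.
have nM : M <= n%:R by near: n; exact: nbhs_infty_ger.
have sq0 : 0 < Num.sqrt (n%:R : R) by rewrite sqrtr_gt0; lra.
have h1 : `|0 - (Num.sqrt (n%:R : R))^-1 / p n| < M'^-1 by near: n; exact: near1.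
have h2 : `|0 - p n / 1| < M'^-1 by near: n; exact: near2.
have MM : M <= M' by rewrite le_max lexx.
have := HM n (p n) p0 p1 nM.
rewrite sub0r normrN divr1 gtr0_norm // in h2.
rewrite sub0r normrN gtr0_norm ?divr_gt0 ?invr_gt0 // -invfM in h1.
rewrite ltf_pV2 ?posrE ?mulr_gt0 // mulrC in h1.
move=> /(_ (le_trans MM (ltW h1))) H.
have {}H : 1 - eta <= Gnp_prob (p n) (A n (p n)).
  apply: H; apply: le_trans (ler_wpM2l (ltW p0) MM) _.
  by rewrite -(mulVf (lt0r_neq0 M'0)) ler_wpM2r // ltW.
have := Gnp_prob_le1 (A n (p n)) (p01 n).
by rewrite ler_norml => H1; lra.
Unshelve. all: by end_near.
Qed.

End Whp.

Theorem theorem3p5 (R : realType) (p : nat -> R)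
    (p01 : forall n, 0 <= p n <= 1)
    (p_lower : much_less (fun n => (Num.sqrt (n%:R : R))^-1) p)
    (p_upper : much_less p (fun=> 1)) :
  (forall (r s : nat) (gamma : R), (4 <= r)%N -> 0 < gamma ->
     whp p (fun n => [set Gam : sgraph 'I_n |
       exists G : sgraph 'I_n,
         [/\ spanning_subgraph G Gam,
             (s <= chi G)%N,
             ((r%:R - 2) / (r%:R - 1) - gamma) * p n * n%:R
               <= (min_degree G)%:R
           & all_subgraphs_colourable G s r.-1]]))
  /\
  (forall (W : finType) (H : sgraph W), (4 <= chi H)%N ->
     ((pi_graph R H)%:E <= delta_chi H p)%E).
Proof.
have part1 (r s : nat) (gamma : R) : (4 <= r)%N -> 0 < gamma ->
    whp p (fun n => @has_sparse_subgraph R n r s gamma (p n)).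
  move=> r4 gamma0.
  apply: (whp_large (A := fun n q => @has_sparse_subgraph R n r s gamma q)) => // eta.
  exact: large_sparse_subgraph.
split=> [r s gamma|W H H4]; first exact: part1.
apply: le_ereal_inf_tmp => _ [d [d0 [C [C0 HC]]] <-].
rewrite lee_fin leNgt; apply/negP => dpi.
(* At least [#|W|], so that local colourability excludes [H], and larger than [C], so that the
   chromatic number exceeds [C]. With [gamma] equal to [pi_graph R H - d], the degree bound becomes
   exactly [d * p n * n]. *)
pose r := chi H; pose s := maxn #|W| (Num.truncn C).+1.
have gamma0 : 0 < pi_graph R H - d by rewrite subr_gt0.
have P1 := part1 r s _ H4 gamma0.
have piE : (r%:R - 2) / (r%:R - 1) = pi_graph R H.
  rewrite /pi_graph -/r; have : r%:R != 1 :> R by rewrite -[1]/(1%:R) eqr_nat; lia.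
  by move=> r1; field; rewrite subr_eq0.
(* For some [n >= s] both events have probability above one half, yet they are disjoint. *)
have h1 := @cvgr_gt _ _ _ _ _ _ P1 (2^-1) ltac:(lra).
have h2 := @cvgr_gt _ _ _ _ _ _ HC (2^-1) ltac:(lra).
have [n [[a1 a2] a3]] := filter_ex (filterI (filterI h1 h2) (nbhs_infty_ge s)).
set A := (X in Gnp_prob _ X) in a1; set B := (X in Gnp_prob _ X) in a2.
have AB Gam : A Gam -> ~ B Gam.
  move=> [G [GG sG dG colG]] BG.
  have Gfree : Defs.free H G.
    apply: free_of_all_subgraphs_colourable colG; first exact: leq_maxl.
      by rewrite card_ord.
    by rewrite prednK // (leq_trans _ H4).
  have := BG G GG Gfree; rewrite piE subKr in dG => /(_ dG).
  apply/negP; rewrite -ltNge; apply: lt_le_trans (truncnS_gt C) _.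
  by rewrite ler_nat (leq_trans (leq_maxr _ _) sG).
have := Gnp_probD_le1 (p01 n) AB; lra.
Qed.
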